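(* Let $q = 2^h$ with $h > 1$, let $n$ be a prime, and let $\mathcal{O} = \{\pi_0, \pi_1, \dots, \pi_{q^n+1}\}$ be a pseudo-hyperoval of $\mathbf{PG}(3n-1, q)$. For each $i \in \{0, 1, \dots, q^n+1\}$ let $\Delta_i$ be the $(n-1)$-spread of a $(2n-1)$-dimensional subspace $\mathbf{PG}(2n-1,q)$ skew to $\pi_i$ obtained by projecting the other elements of $\mathcal{O}$ from $\pi_i$, i.e. $\Delta_i = \{\langle \pi_i, \pi_j\rangle \cap \mathbf{PG}(2n-1,q) : j \neq i\}$. Then $\mathcal{O}$ is regular if and only if all the $(n-1)$-spreads $\Delta_0, \Delta_1, \dots, \Delta_{q^n+1}$ are regular.
   Context: A generalized $k$-arc of $\mathbf{PG}(3n-1,q)$ is a set of $k$ subspaces of dimension $n-1$ any three of which span $\mathbf{PG}(3n-1,q)$. For $q$ even, a pseudo-hyperoval is a generalized $(q^n+2)$-arc; a pseudo-oval is a generalized $(q^n+1)$-arc. For a pseudo-hyperoval, $\Delta_i$ is indeed an $(n-1)$-spread (a partition of the point set of $\mathbf{PG}(2n-1,q)$ into $(n-1)$-dimensional subspaces); its regularity does not depend on the chosen complement $\mathbf{PG}(2n-1,q)$. An $(n-1)$-regulus of $\mathbf{PG}(2n-1,q)$ is a set of $q+1$ pairwise disjoint $(n-1)$-dimensional subspaces such that every line meeting three of them meets all of them, and every point of such a transversal line lies in one of them (equivalently, the system of maximal subspaces of one family of a Segre variety $\mathcal{S}_{1;n-1}$); any three pairwise disjoint $(n-1)$-spaces of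 $\mathbf{PG}(2n-1,q)$ lie in a unique $(n-1)$-regulus. An $(n-1)$-spread is regular if for any three of its elements the $(n-1)$-regulus they determine is contained in the spread. Regular pseudo-hyperoval: in the extension $\mathbf{PG}(3n-1,q^n)$ take planes $\xi_1,\dots,\xi_n$ forming an orbit of the Galois group $\mathrm{Gal}(\mathbb{F}_{q^n}/\mathbb{F}_q)$ and spanning $\mathbf{PG}(3n-1,q^n)$; take a hyperoval $\{x_0^{(1)},\dots,x_{q^n+1}^{(1)}\}$ of $\xi_1$ (a set of $q^n+2$ points no three collinear), let $x_i^{(1)},\dots,x_i^{(n)}$ be the Galois conjugates of $x_i^{(1)}$, and let $\pi_i$ be the $(n-1)$-dimensional subspace over $\mathbb{F}_q$ they span. The resulting set $\{\pi_0,\dots,\pi_{q^n+1}\}$ is a pseudo-hyperoval of $\mathbf{PG}(3n-1,q)$; pseudo-hyperovals arising this way (up to projective equivalence) are called regular. *)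

(* Defs.v *)
From HB Require Import structures.
From mathcomp Require Import all_boot all_algebra all_field.

Set Implicit Arguments.
Unset Strict Implicit.
Unset Printing Implicit Defensive.

Import GRing.Theory.
Local Open Scope ring_scope.

(* A projective subspace of dimension d is a vector subspace of dimension
   d + 1: points, lines and planes have \dim 1, 2 and 3, and two subspaces are
   disjoint (skew) when their intersection is 0%VS. *)

Definition generalized_arc (F : finFieldType) (n k : nat)
    (pi : 'I_k -> {vspace 'rV[F]_(3 * n)}) : Prop :=
  [/\ injective pi,
      forall i, \dim (pi i) = n
    & forall i j l, i != j -> i != l -> j != l ->
        (pi i + pi j + pi l)%VS = fullv].

Definition pseudo_hyperoval (F : finFieldType) (n : nat)
    (pi : 'I_(#|F| ^ n + 2) -> {vspace 'rV[F]_(3 * n)}) : Prop :=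
  generalized_arc pi.

Definition is_spread (F : finFieldType) (V : vectType F) (n : nat)
    (W : {vspace V}) (S : seq {vspace V}) : Prop :=
  [/\ forall U, U \in S -> (U <= W)%VS /\ \dim U = n,
      forall A B, A \in S -> B \in S -> A != B -> (A :&: B = 0)%VS
    & forall P : {vspace V}, \dim P = 1%N -> (P <= W)%VS ->
        exists2 U, U \in S & (P <= U)%VS].

Definition is_regulus (F : finFieldType) (V : vectType F) (n : nat)
    (W : {vspace V}) (R : seq {vspace V}) : Prop :=
  [/\ uniq R /\ size R = (#|F| + 1)%N,
      forall U, U \in R -> (U <= W)%VS /\ \dim U = n,
      forall A B, A \in R -> B \in R -> A != B -> (A :&: B = 0)%VS
    & forall (l A B C : {vspace V}),
        \dim l = 2%N -> (l <= W)%VS ->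
        A \in R -> B \in R -> C \in R -> A != B -> A != C -> B != C ->
        (l :&: A != 0)%VS -> (l :&: B != 0)%VS -> (l :&: C != 0)%VS ->
        (forall U, U \in R -> (l :&: U != 0)%VS) /\
        (forall P : {vspace V}, \dim P = 1%N -> (P <= l)%VS ->
           exists2 U, U \in R & (P <= U)%VS)].

(* Any three pairwise disjoint members lie in exactly one regulus (as a set),
   so "the regulus they determine" can be introduced existentially. *)
Definition regular_spread (F : finFieldType) (V : vectType F) (n : nat)
    (W : {vspace V}) (S : seq {vspace V}) : Prop :=
  is_spread n W S /\
  forall A B C, A \in S -> B \in S -> C \in S -> A != B -> A != C -> B != C ->
    exists R, [/\ is_regulus n W R, [/\ A \in R, B \in R & C \in R]
                & {subset R <= S}].

Definition projected_spread (F : finFieldType) (V : vectType F) (k : nat)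
    (pi : 'I_k -> {vspace V}) (i : 'I_k) (W : {vspace V}) : seq {vspace V} :=
  [seq ((pi i + pi j) :&: W)%VS | j in predC1 i].

(* For a field morphism f this is the span of the image of U under the
   coordinatewise action of f, hence independent of the basis. It is used with
   f = in_alg L (extension of scalars) and f in a Galois group (conjugation). *)
Definition map_vspace (K L : fieldType) (m : nat) (f : K -> L)
    (U : {vspace 'rV[K]_m}) : {vspace 'rV[L]_m} :=
  <<[seq map_mx f v | v <- vbasis U]>>%VS.

Definition hyperoval_in (L : fieldType) (m k : nat) (xi : {vspace 'rV[L]_m})
    (x : 'I_k -> {vspace 'rV[L]_m}) : Prop :=
  [/\ injective x,
      forall i, \dim (x i) = 1%N /\ (x i <= xi)%VS
    & forall i j l, i != j -> i != l -> j != l ->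
        ~ exists2 t : {vspace 'rV[L]_m}, \dim t = 2%N &
            [/\ (x i <= t)%VS, (x j <= t)%VS & (x l <= t)%VS]].

(* The n conjugates of xi span a space of dimension 3n, so they are
   automatically distinct. *)
Definition field_reduced_hyperoval (F : finFieldType) (n : nat)
    (pi : 'I_(#|F| ^ n + 2) -> {vspace 'rV[F]_(3 * n)}) : Prop :=
  exists (L : splittingFieldType F) (xi : {vspace 'rV[L]_(3 * n)})
         (x : 'I_(#|F| ^ n + 2) -> {vspace 'rV[L]_(3 * n)}),
    [/\ \dim {:L} = n,
        \dim xi = 3%N,
        (\sum_(s in 'Gal({:L} / 1)%g) map_vspace s xi)%VS = fullv,
        hyperoval_in xi x
      & forall i, map_vspace (in_alg L) (pi i) =
                  (\sum_(s in 'Gal({:L} / 1)%g) map_vspace s (x i))%VS].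

Definition regular_pseudo_hyperoval (F : finFieldType) (n : nat)
    (pi : 'I_(#|F| ^ n + 2) -> {vspace 'rV[F]_(3 * n)}) : Prop :=
  exists (g : 'End('rV[F]_(3 * n)))
         (pi' : 'I_(#|F| ^ n + 2) -> {vspace 'rV[F]_(3 * n)}),
    [/\ lker g = 0%VS,
        field_reduced_hyperoval pi'
      & forall i, pi i = (g @: pi' i)%VS].

(* Main.v *)
(* A regular spread with q > 2 has, in coordinates, a spread set of n x n
   matrices that is a linear space closed under inversion; Hua's identity and
   the primality of n turn it into a field F[M], for any nonscalar M in it.
   Fix four elements a, b, c, d of the pseudo-hyperoval and a frame in which
   the other ones are the row spaces of (A_j, B_j, 1).  Projecting from a, b and
   c shows that the B_j, the A_j and the A_j^-1 B_j, each with 0 added, form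
   fields, any two of which coincide once they share a nonscalar matrix.  A
   regulus of the spread seen from d yields a fourth relation, which forces such
   a coincidence, so all elements are subspaces over one field F[M].  An
   eigenvector v of M over L = F_{q^n} then gives the plane and its hyperoval:
   by Galois descent, the conjugates of v P_j span the element with row space P_j.
   Conversely the trace identifies the plane xi with F^{3n}, so every quotient
   by an element is a plane over L whose F-sublines are the reguli. *)
Require Import Defs.
From HB Require Import structures.
From mathcomp Require Import all_boot all_algebra all_field.
From mathcomp Require Import zify ring.

Set Implicit Arguments.
Unset Strict Implicit.
Unset Printing Implicit Defensive.

Import GRing.Theory.
Local Open Scope ring_scope.

(** * Spread sets of matrices *)

(** Each viewpoint alone yields a field, but a priori its own: the spread sets seen from three
    elements are three subfields of the matrix ring with no nonscalar matrix visibly in common.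
    Primality of [n] makes one shared nonscalar matrix enough: there is no room for a proper
    intermediate field, so that matrix already generates [q^n] elements and fills both spread sets.
    The bound [q > 2] gives regularity its content: a regulus has [q + 1] elements, so for [q = 2]
    the three given ones exhaust it. Descent is done by the trace from [L^m] to [F^m], which is
    [F]-linear and commutes with matrices over [F]: an equality between an extension of scalars and
    a sum of conjugates is obtained by checking that the trace maps one space onto the other. *)

Section MatrixFields.

Variables (F : finFieldType) (n' : nat).
Local Notation n := n'.+1.
Implicit Types (M N : 'M[F]_n) (S : {set 'M[F]_n}).

Lemma dim_rV (K : fieldType) m : \dim {:'rV[K]_m} = m.
Proof. by rewrite dimvf dim_matrix [LHS]mul1n. Qed.

Lemma unitmxP_row M : (forall y : 'rV_n, y *m M = 0 -> y = 0) -> M \is a GRing.unit.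
Proof.
move=> inj; rewrite -[_ \is a _]/(M \in unitmx) -row_free_unit.
by apply/row_freeP; exists (invmx M); apply: mulmxV; rewrite -row_free_unit -kermx_eq0;
  apply/eqP/row_matrixP => i; rewrite row0; apply: inj; rewrite -row_mul mulmx_ker row0.
Qed.

(* Greedy decomposition of the row space into cyclic modules. *)
Lemma dim_matrix_skew_field_dvd (K : {vspace 'M[F]_n}) :
    1 \in K -> {in K &, forall M N, M * N \in K} ->
    {in K, forall M, M != 0 -> M \is a GRing.unit} ->
  (\dim K %| n)%N.
Proof.
move=> K1 KM Kunit; set d := \dim K.
pose stable (U : {vspace 'rV[F]_n}) :=
  forall x M, x \in U -> M \in K -> x *m M \in U.
suffices [U [_ dvdU]]: exists U, [/\ stable U, (d %| \dim U)%N & (n <= \dim U)%N].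
  move=> leU; suffices <- : \dim U = n by [].
  by apply/eqP; rewrite eqn_leq leU andbT -{3}(dim_rV F n) dimvS ?subvf.
suffices: forall k, exists U, [/\ stable U, (d %| \dim U)%N & (minn n k <= \dim U)%N].
  by move/(_ n); rewrite minnn.
elim=> [|k [U [stU dU leU]]].
  exists 0%VS; split; rewrite ?dimv0 ?dvdn0 ?minn0 // => x M.
  by rewrite memv0 => /eqP-> _; rewrite mul0mx mem0v.
have [fullU | ] := boolP (fullv <= U)%VS.
  exists U; split=> //; apply: leq_trans (geq_minl _ _) _.
  by have := dimvS fullU; rewrite dim_rV.
case/subvPn=> v _ Uv; pose f := linfun (fun M => v *m M).
have fE M : f M = v *m M by rewrite lfunE.
(* A nonzero [M] in [K] is invertible and maps the stable space [U] onto itself, so [v *m M] in [U]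
   would bring [v] back into [U]. *)
have KU : {in K, forall M, v *m M \in U -> M = 0}.
  move=> M KM' vMU; apply/eqP; apply: contraNT Uv => /(Kunit M KM') Mu.
  pose g := linfun (mulmxr M : 'rV_n -> 'rV_n).
  have gE x : g x = x *m M by rewrite lfunE.
  have ginj : lker g == 0%VS.
    apply/lker0P => x y; rewrite !gE => /(congr1 (mulmxr (invmx M))) /=.
    by rewrite !mulmxK.
  suffices gU : (g @: U)%VS = U.
    by move: vMU; rewrite -{1}gU => /memv_imgP[x xU]; rewrite -gE => /(lker0P ginj)->.
  apply/eqP; rewrite eqEdim limg_dim_eq ?(eqP ginj) ?capv0 // leqnn andbT.
  by apply/subvP=> _ /memv_imgP[x xU ->]; rewrite gE stU.
have kf : (K :&: lker f = 0)%VS.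
  apply/eqP; rewrite -subv0; apply/subvP => M /memv_capP[KM'].
  by rewrite memv_ker fE => /eqP vM0; rewrite memv0 (KU M) // vM0 mem0v.
have UfK : (U :&: f @: K = 0)%VS.
  apply/eqP; rewrite -subv0; apply/subvP => x /memv_capP[xU /memv_imgP[M KM' xE]].
  by move: xU; rewrite xE fE memv0 => /(KU M KM')->; rewrite mulmx0.
have dU' : \dim (U + f @: K) = (\dim U + d)%N.
  by rewrite dimv_disjoint_sum // limg_dim_eq.
exists (U + f @: K)%VS; split; rewrite ?dU' ?dvdn_add //.
  move=> x M /memv_addP[u uU [_ /memv_imgP[N NK ->] ->]] KM'.
  by rewrite mulmxDl memv_add ?stU // fE -mulmxA -fE memv_img // KM.
have d0 : (0 < d)%N.
  by rewrite lt0n dimv_eq0; apply: contraTneq K1 => ->; rewrite memv0 oner_neq0.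
rewrite minnC geq_min; move: leU; rewrite geq_min => /orP[le | le].
  by rewrite (leq_trans le) ?leq_addr ?orbT.
by rewrite -addn1 leq_add.
Qed.

(** The algebra [F[M]]. Evaluating only polynomials of degree below that of the minimal polynomial
    makes the map injective, which gives the dimension. *)
Definition mx_poly_span M : {vspace 'M[F]_n} :=
  limg (linfun (horner_mx M \o rVpoly : 'rV_(degree_mxminpoly M) -> _)).

Lemma mx_poly_spanP M N :
  reflect (exists p, N = horner_mx M p) (N \in mx_poly_span M).
Proof.
apply: (iffP memv_imgP) => [[r _ ->] | [p ->]]; first by exists (rVpoly r); rewrite lfunE.
exists (poly_rV (p %% mxminpoly M)); rewrite ?memvf // lfunE /=.
rewrite poly_rV_K ?size_mod_mxminpoly // [in LHS](divp_eq p (mxminpoly M)).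
by rewrite rmorphD rmorphM /= mx_root_minpoly mulr0 add0r.
Qed.

Lemma dim_mx_poly_span M : \dim (mx_poly_span M) = degree_mxminpoly M.
Proof.
rewrite limg_dim_eq ?dim_rV //; apply/eqP; rewrite capfv; apply/lker0P => x y.
by rewrite !lfunE; apply: horner_rVpoly_inj.
Qed.

(* [S] is the spread set of a regular spread containing the graphs of [0] and
   [1]: the last two clauses say that [S] is closed under the reguli through
   infinity, respectively through [0] and [1]. *)
Definition regular_spread_set S : Prop :=
  [/\ 0 \in S /\ 1 \in S,
      {in S &, forall M N, M != N -> M - N \is a GRing.unit},
      forall t : F, {in S &, forall M N, M + t *: (N - M) \in S},
      forall t : F, {in S, forall M, 1 + t *: (M - 1) != 0 ->
        (1 + t *: (M - 1))^-1 * M \in S}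
    & #|S| = (#|F| ^ n)%N].

Section RegularSpreadSet.

Variable S : {set 'M[F]_n}.
Hypotheses (q_gt2 : (2 < #|F|)%N) (n_pr : prime n) (regS : regular_spread_set S).

(** At the parameters 0 and 1 affine closure only returns the two given matrices; a third scalar is
    what turns it into closure under sums. *)
Lemma exists_scalar_neq01 : exists t : F, t != 0 /\ t != 1.
Proof.
have [t] : exists t, t \in ~: [set (0 : F); 1].
  apply/card_gt0P; rewrite -(ltn_add2l #|[set (0 : F); 1]|) cardsC addn0.
  by apply: leq_ltn_trans q_gt2; rewrite cards2 eq_sym oner_neq0.
by rewrite !inE negb_or => /andP[? ?]; exists t.
Qed.

Lemma spread_setZ t M : M \in S -> t *: M \in S.
Proof.
case: regS => -[S0 _] _ aff _ _ MS.
by have := aff t _ _ S0 MS; rewrite add0r subr0.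
Qed.

(** [M + N] is the point of parameter [t] on the affine line from [(1 - t)^-1 *: M] to
    [t^-1 *: N]. *)
Lemma spread_setD M N : M \in S -> N \in S -> M + N \in S.
Proof.
case: regS => _ _ aff _ _ MS NS; have [t [t0 t1]] := exists_scalar_neq01.
have t1' : 1 - t != 0 by rewrite subr_eq0 eq_sym.
have := aff t _ _ (spread_setZ (1 - t)^-1 MS) (spread_setZ t^-1 NS).
rewrite scalerBr [t *: (t^-1 *: _)]scalerA mulfV // scale1r addrCA.
rewrite -[X in N + (X - _)]scale1r -scalerBl scalerA mulfV //.
by rewrite scale1r addrC.
Qed.

Lemma spread_setN M : M \in S -> - M \in S.
Proof. by rewrite -scaleN1r; apply: spread_setZ. Qed.

Lemma spread_setB M N : M \in S -> N \in S -> M - N \in S.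
Proof. by move=> MS NS; rewrite spread_setD ?spread_setN. Qed.

Lemma spread_set_scalar t : t%:M \in S.
Proof. by case: regS => -[_ S1] _ _ _ _; rewrite -scalemx1 spread_setZ. Qed.

Lemma spread_set_unit M : M \in S -> M != 0 -> M \is a GRing.unit.
Proof.
by case: regS => -[S0 _] dU _ _ _ MS M0; have := dU _ _ MS S0 M0; rewrite subr0.
Qed.

Lemma spread_setV M : M \in S -> M^-1 \in S.
Proof.
have [-> | M0 MS] := eqVneq M 0; first by rewrite invr0.
case: regS => -[_ S1] _ _ inv _; have [t [t0 t1]] := exists_scalar_neq01.
have Mu := spread_set_unit MS M0.
(* [N] solves [1 + t (N - 1) = M], so the inversion clause puts [M^-1 N = t^-1 + (1 - t^-1) M^-1] in
   [S]; as [t] is not 1, this isolates [M^-1]. *)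
pose N := t^-1 *: (M - 1) + 1.
have NS : N \in S by rewrite spread_setD ?spread_setZ ?spread_setB.
have MN : 1 + t *: (N - 1) = M.
  by rewrite addrK scalerA mulfV // scale1r addrC subrK.
have := inv t _ NS; rewrite MN => /(_ M0).
rewrite /N mulrDr mulr1 -scalerAr mulrBr mulVr // mulr1 scalerBr addrAC -addrA.
move=> /(spread_setB (spread_setZ t^-1 S1)); rewrite opprD addNKr opprB.
rewrite -[X in _ - X]scale1r -scalerBl => /(spread_setZ (t^-1 - 1)^-1).
rewrite scalerA mulVf ?scale1r //.
by rewrite subr_eq0 invr_eq1.
Qed.

(* Hua's identity with both variables in the field generated by [M]. *)
Lemma spread_setX M k : M \in S -> M ^+ k \in S.
Proof.
move=> MS; elim/ltn_ind: k => -[|[|k]] IH; rewrite ?expr0 ?expr1 //.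
  by case: regS => -[_ S1].
have [-> | M0] := eqVneq M 0; first by rewrite expr0n /=; case: regS => -[].
have Mu := spread_set_unit MS M0.
(* The degenerate case, in which [(M ^+ k)^-1 - M] vanishes; the required power is then [M]
   itself. *)
have [E1 | nE1] := eqVneq (M ^+ k.+1) 1; first by rewrite exprS E1 mulr1.
have XS := spread_setV (IH k (leqnSn _)).
have commX j : GRing.comm M (M ^+ j) by apply: commrX.
have D0 : (M ^+ k)^-1 - M != 0.
  rewrite subr_eq0; apply: contra nE1 => /eqP E.
  by rewrite exprSr -[X in _ * X]E mulrV ?unitrX.
have Du := spread_set_unit (spread_setB XS MS) D0.
(* The identity is [a - (a^-1 + (b^-1 - a)^-1)^-1 = a b a], for [a = M] and [b = M ^+ k]. *)
pose T := M^-1 + ((M ^+ k)^-1 - M)^-1.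
have TS : T \in S by rewrite spread_setD ?spread_setV ?spread_setB.
suffices TE : (M - M ^+ k.+2) * T = 1.
  have Tu : T \is a GRing.unit.
    by apply/unitrP; exists (M - M ^+ k.+2); split=> //; apply: mulmx1C.
  have := spread_setB MS (spread_setV TS).
  suffices -> : T^-1 = M - M ^+ k.+2 by rewrite opprB addrC subrK.
  by rewrite -[LHS]mul1r -TE mulrK.
have XD : M ^+ k.+1 * ((M ^+ k)^-1 - M) = M - M ^+ k.+2.
  by rewrite mulrBr -exprSr exprS mulrK ?unitrX.
rewrite mulrDr -{2}XD mulrK // exprSr mulrBl mulrV // mulrK //.
by rewrite subrK.
Qed.

Lemma spread_set_horner M p : M \in S -> horner_mx M p \in S.
Proof.
move=> MS; rewrite -(coefK p) poly_def rmorph_sum /=.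
apply: (big_ind (fun x => x \in S)) => [||i _]; first by case: regS => -[].
  exact: spread_setD.
by rewrite linearZ rmorphXn /= horner_mx_X spread_setZ ?spread_setX.
Qed.

(** [F[M]] lies in [S], so its nonzero elements are invertible and its degree divides [n]. The
    degree is not 1, hence it is [n], and [F[M]] has as many elements as [S]. *)
Theorem regular_spread_set_field M : M \in S -> ~~ is_scalar_mx M ->
  forall N, (N \in S) = (N \in mx_poly_span M).
Proof.
move=> MS Msc.
have sub : {subset mx_poly_span M <= S}.
  by move=> N /mx_poly_spanP[p ->]; apply: spread_set_horner.
have dvd : (\dim (mx_poly_span M) %| n)%N.
  apply: dim_matrix_skew_field_dvd => [|_ _ /mx_poly_spanP[p ->] /mx_poly_spanP[r ->]|N].
  - by apply/mx_poly_spanP; exists 1; rewrite rmorph1.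
  - by apply/mx_poly_spanP; exists (p * r); rewrite rmorphM.
  by move/sub/spread_set_unit.
have /eqP dimK : \dim (mx_poly_span M) == n.
  case/primeP: n_pr => _ /(_ _ dvd)/orP[|//].
  by rewrite dim_mx_poly_span => /eqP d1; rewrite -mxminpoly_linear_is_scalar d1 in Msc.
have cardE : #|S| = #|mx_poly_span M|.
  by case: regS => _ _ _ _ ->; rewrite card_vspace dimK.
move=> N; apply/idP/idP; last exact: sub.
by rewrite -(subset_cardP (esym cardE) (introT subsetP sub) N).
Qed.

Lemma degree_mxminpoly_spread_set M : M \in S -> ~~ is_scalar_mx M ->
  degree_mxminpoly M = n.
Proof.
move=> MS Msc; have SE := regular_spread_set_field MS Msc.
apply/eqP; rewrite -(@eqn_exp2l #|F|) ?(ltnW q_gt2) //.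
rewrite -dim_mx_poly_span -card_vspace -(eq_card SE).
by case: regS => _ _ _ _ ->.
Qed.

Lemma spread_set_nonscalar : exists2 M, M \in S & ~~ is_scalar_mx M.
Proof.
apply/exists_inP; apply: contraT => /exists_inPn sc.
have : (#|S| <= #|[set (t%:M : 'M[F]_n) | t in F]|)%N.
  apply/subset_leq_card/subsetP => M /sc/negbNE/is_scalar_mxP[t ->].
  exact: imset_f.
case: regS => _ _ _ _ ->; rewrite leqNgt => /negP[].
apply: leq_ltn_trans (leq_imset_card _ _) _.
by rewrite -[X in (X < _)%N]expn1 ltn_exp2l; [apply: prime_gt1 | apply: ltnW].
Qed.

Lemma spread_setM M N : M \in S -> N \in S -> M * N \in S.
Proof.
move=> MS NS; have [/is_scalar_mxP[t ->] | Msc] := boolP (is_scalar_mx M).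
  by rewrite -[t%:M * N]/(t%:M *m N) mul_scalar_mx spread_setZ.
have SE := regular_spread_set_field MS Msc.
move: NS; rewrite !SE => /mx_poly_spanP[p ->]; apply/mx_poly_spanP.
by exists ('X * p); rewrite rmorphM /= horner_mx_X.
Qed.

Lemma mxminpoly_spread_set_irreducible M : M \in S -> irreducible_poly (mxminpoly M).
Proof.
move=> MS; split=> [|r r1 /dvdpP[s pE]].
  by rewrite size_mxminpoly ltnS mxminpoly_nonconstant.
have p0 : mxminpoly M != 0 by rewrite monic_neq0 ?mxminpoly_monic.
have [s0 r0] : s != 0 /\ r != 0 by apply/andP; rewrite -negb_or -mulf_eq0 -pE.
have := mx_root_minpoly M; rewrite pE rmorphM /= => sr0.
have [rM0 | rM0] := eqVneq (horner_mx M r) 0.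
  by rewrite -pE /eqp dvd_mxminpoly rM0 eqxx andbT pE dvdp_mull.
have ru := spread_set_unit (spread_set_horner r MS) rM0.
have /mxminpoly_min : horner_mx M s = 0.
  by rewrite -[LHS](mulrK ru) sr0 mul0r.
move/dvdp_leq => /(_ s0); rewrite pE size_mul // -ltnS prednK; last first.
  by rewrite addn_gt0 lt0n size_poly_eq0 s0.
rewrite -[X in (_ <= X)%N]addn1 leq_add2l => r_le1.
by case/negP: r1; rewrite eqn_leq r_le1 lt0n size_poly_eq0.
Qed.

End RegularSpreadSet.

Lemma spread_set_share S T M :
    (2 < #|F|)%N -> prime n -> regular_spread_set S -> regular_spread_set T ->
  M \in S -> M \in T -> ~~ is_scalar_mx M -> S = T.
Proof.
move=> q2 npr rS rT MS MT Msc; apply/setP => N.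
by rewrite (regular_spread_set_field q2 npr rS MS) // -(regular_spread_set_field q2 npr rT MT).
Qed.

Lemma is_scalar_mxZ t M : is_scalar_mx M -> is_scalar_mx (t *: M).
Proof. by case/is_scalar_mxP=> u ->; rewrite scale_scalar_mx scalar_mx_is_scalar. Qed.

(* [S1], [S2] and [S3] are the spread sets seen from three elements of the
   pseudo-hyperoval.  By primality two of them sharing a nonscalar matrix
   coincide, and then so does the third; [hd] comes from the spread seen from a
   fourth element and produces such a shared matrix. *)
Lemma spread_sets_coincide (I : Type) (P : I -> Prop) (A B : I -> 'M[F]_n)
    (S1 S2 S3 : {set 'M[F]_n}) :
    (2 < #|F|)%N -> prime n -> regular_spread_set S1 ->
    regular_spread_set S2 -> regular_spread_set S3 ->
    (forall j, P j -> [/\ A j \in S2, A j != 0, B j \in S1, B j != 0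
                        & (A j)^-1 * B j \in S3]) ->
    (forall M, M \in S1 -> M != 0 -> exists2 j, P j & B j = M) ->
    (forall M, M \in S2 -> M != 0 -> exists2 j, P j & A j = M) ->
    (forall (t : F) j, t != 0 -> P j -> A j != 1 -> B j != 1 ->
       A j - 1 = t *: (B j - 1) \/
       exists N, exists2 m, P m & [/\ A m != 1, B m != 1,
         A j - 1 = N * (A m - 1) & t *: (B j - 1) = N * (B m - 1)]) ->
  S1 = S2.
Proof.
move=> q2 npr r1 r2 r3 hAB surj1 surj2 hd.
have sc_neq M t : ~~ is_scalar_mx M -> M != t%:M.
  by apply: contraNneq => ->; rewrite scalar_mx_is_scalar.
have share12 M : M \in S1 -> M \in S2 -> ~~ is_scalar_mx M -> S1 = S2.
  exact: spread_set_share.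
have [M0 M0S M0sc] := spread_set_nonscalar q2 npr r1.
have M00 : M0 != 0 by have := sc_neq _ 0 M0sc; rewrite raddf0.
have [j Pj yE] := surj1 _ M0S M00.
have [AS A0 BS B0 wS] := hAB j Pj.
have Au M (MS : M \in S2) (M_neq0 : M != 0) := spread_set_unit r2 MS M_neq0.
(* Once [S1 = S3], the identity [A = B (A^-1 B)^-1] carries a nonscalar [A i] of [S2] into [S1]. *)
have share13 M : M \in S1 -> M \in S3 -> ~~ is_scalar_mx M -> S1 = S2.
  move=> M1 M3 Msc; have E13 := spread_set_share q2 npr r1 r3 M1 M3 Msc.
  have [N NS Nsc] := spread_set_nonscalar q2 npr r2.
  have N0 : N != 0 by have := sc_neq _ 0 Nsc; rewrite raddf0.
  have [i Pi iE] := surj2 _ NS N0; have [AiS Ai0 BiS Bi0 wiS] := hAB i Pi.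
  apply: (share12 N) => //; rewrite -iE.
  have Aiu := Au _ AiS Ai0; have Biu := spread_set_unit r1 BiS Bi0.
  have -> : A i = B i * ((A i)^-1 * B i)^-1.
    by rewrite invrM ?unitrV // invrK mulVKr.
  by rewrite spread_setM // E13 spread_setV // -E13.
have share23 M : M \in S2 -> M \in S3 -> ~~ is_scalar_mx M -> S1 = S2.
  move=> M2 M3 Msc; have E23 := spread_set_share q2 npr r2 r3 M2 M3 Msc.
  apply: (share12 (B j)); rewrite ?yE // -yE.
  by rewrite -[B j](mulVKr (Au _ AS A0)) spread_setM // E23.
have Bsc : ~~ is_scalar_mx (B j) by rewrite yE.
have Aju := Au _ AS A0.
(* For scalar [A j], the matrix [(A j)^-1 * B j] is a nonscalar element of both [S1] and [S3]. *)
have [Asc | Asc] := boolP (is_scalar_mx (A j)).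
  have [a AE] := is_scalar_mxP Asc.
  have a0 : a != 0 by apply: contraNneq A0 => a0; rewrite AE a0 raddf0.
  apply: (share13 ((A j)^-1 * B j)) => //.
    by rewrite spread_setM ?spread_setV // AE spread_set_scalar.
  apply: contra Bsc => wsc; rewrite -[B j](mulVKr Aju) {1}AE.
  by rewrite [_ * _]mul_scalar_mx is_scalar_mxZ.
have A1 : A j != 1 by apply: (sc_neq _ 1).
have B1 : B j != 1 by apply: (sc_neq _ 1).
have [t [t0 t1]] := exists_scalar_neq01 q2.
have S1_1 : 1 \in S1 by case: r1 => -[].
have S2_1 : 1 \in S2 by case: r2 => -[].
have S3_1 : 1 \in S3 by case: r3 => -[].
case: (hd t j t0 Pj A1 B1) => [E | [N [m Pm [Am1 Bm1 EA EB]]]].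
  apply: (share12 (A j)) => //; rewrite -[A j](subrK 1) E.
  by rewrite spread_setD ?spread_setZ ?spread_setB.
have [AmS Am0 BmS Bm0 kS] := hAB m Pm.
have Amu : A m - 1 \is a GRing.unit.
  by rewrite (spread_set_unit r2) ?subr_eq0 ?spread_setB.
have Bmu : B m - 1 \is a GRing.unit.
  by rewrite (spread_set_unit r1) ?subr_eq0 ?spread_setB.
(* [N] is a quotient of elements of [S1] by one relation and of elements of [S2] by the other, so a
   nonscalar [N] is shared. *)
have [Nsc | Nsc] := boolP (is_scalar_mx N); last first.
  apply: (share12 N) => //.
    rewrite -[N](mulrK Bmu) -EB; apply: spread_setM => //.
      by rewrite spread_setZ ?spread_setB.
    by rewrite spread_setV ?spread_setB.
  rewrite -[N](mulrK Amu) -EA; apply: spread_setM; rewrite ?spread_setB //.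
  by rewrite spread_setV ?spread_setB.
have [v NE] := is_scalar_mxP Nsc.
have v0 : v != 0.
  by apply: contraNneq A1 => v0; rewrite -subr_eq0 EA NE v0 raddf0 mul0r.
move: EA EB; rewrite NE ![_%:M * _]mul_scalar_mx.
move=> /(congr1 ( *:%R v^-1)); rewrite scalerA mulVf // scale1r => EA.
move=> /(congr1 ( *:%R v^-1)); rewrite !scalerA mulVf // scale1r => EB.
set w := (A j)^-1 * B j in wS; set k := (A m)^-1 * B m in kS.
set u := v^-1 in EA EB.
have BjE : B j = A j * w by rewrite mulVKr.
have BmE : B m = A m * k by rewrite mulVKr // Au.
(* For scalar [N] both relations express [A m] and [B m] through [A j] and [B j]. Substituting them
   in [B m = A m * k] and [B j = A j * w] leaves one equation, linear in [A j], with coefficients in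
   [S3]. *)
have key : A j * (u *: k - (u * t) *: w) = (1 - u * t)%:M - (1 - u) *: k.
  have {}EA : A m = u *: (A j - 1) + 1 by rewrite EA subrK.
  have {}EB : B m = (u * t) *: (B j - 1) + 1 by rewrite EB subrK.
  move: EB; rewrite BmE EA BjE mulrDl mul1r -scalerAl mulrBl mul1r mulrBr -!scalerAr.
  move: (A j * k) (A j * w) => X Y EB; apply/matrixP => r s.
  have /eqP := congr1 (fun Z : 'M_n => Z r s) EB; rewrite -subr_eq0 !mxE => /eqP E0.
  by apply/eqP; rewrite -subr_eq0 -[X in _ == X]E0 -mulr_natr; apply/eqP; ring.
have DS : u *: k - (u * t) *: w \in S3 by rewrite spread_setB ?spread_setZ.
have [D0 | D0] := eqVneq (u *: k - (u * t) *: w) 0; last first.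
  apply: (share23 (A j)) => //; rewrite -[A j](mulrK (spread_set_unit r3 DS D0)) key.
  apply: spread_setM; rewrite ?spread_setV //.
  by rewrite spread_setB ?spread_setZ ?spread_set_scalar.
(* If the coefficient of [A j] vanishes, then [k = t w] and [(1 - u) k] is scalar. Since [u = 1]
   would force [t = 1], the matrix [w] is scalar and [B j = A j * w] lies in [S2]. *)
have u0 : u != 0 by rewrite invr_eq0.
have kE : k = t *: w.
  by apply: (scalerI u0); apply/eqP; rewrite scalerA -subr_eq0 D0.
move/esym: key; rewrite D0 mulr0 => /eqP; rewrite subr_eq0 => /eqP key.
have u1 : 1 - u != 0.
  apply: contraNneq t1 => u1; move: key; rewrite u1 scale0r.
  move/eqP: u1; rewrite subr_eq0 => /eqP <-; rewrite mul1r => /matrixP/(_ 0 0).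
  by rewrite !mxE eqxx mulr1n => /eqP; rewrite subr_eq0 eq_sym.
have wsc : is_scalar_mx w.
  have -> : w = (t^-1 * (1 - u)^-1) *: (1 - u * t)%:M.
    by rewrite key kE !scalerA mulfVK // mulVf // scale1r.
  exact/is_scalar_mxZ/scalar_mx_is_scalar.
apply: (share12 (B j)) => //; rewrite BjE; have [c ->] := is_scalar_mxP wsc.
by rewrite [_ * _]mul_mx_scalar spread_setZ.
Qed.

End MatrixFields.

(** * Reguli and generalized arcs *)

Lemma dim_span2 (K : fieldType) (V : vectType K) (a b : V) : a != 0 -> b \notin <[a]>%VS -> \dim (<[a]> + <[b]>) = 2%N.
Proof.
move=> a0 ab; have b0 : b != 0 by apply: contraNneq ab => ->; rewrite mem0v.
rewrite dimv_disjoint_sum ?dim_vline ?a0 ?b0 //.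
apply/eqP; rewrite -subv0; apply/subvP => x /memv_capP[xa /vlineP[s xE]].
rewrite memv0 xE; apply: contraNT ab; rewrite xE in xa *.
rewrite scaler_eq0 negb_or => /andP[s0 _].
by have := memvZ s^-1 xa; rewrite scalerA mulVf // scale1r.
Qed.

Section Reguli.

Variables (F : finFieldType) (V : vectType F) (n : nat) (W : {vspace V}).

(** Each pair [a], [b] with [a + b] in [C] spans a transversal line, so [a + t *: b] lies in some
    member. The content is that one member serves all pairs; it is found from a reference pair and
    propagated by comparing the transversals of two pairs and of their sum. *)
Lemma regulus_transversal (R : seq {vspace V}) (A B C : {vspace V}) (t : F) :
    is_regulus n W R -> A \in R -> B \in R -> C \in R ->
    A != B -> A != C -> B != C ->
  exists2 U, U \in R &
    forall a b, a \in A -> b \in B -> a + b \in C -> a + t *: b \in U.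
Proof.
case=> _ RW Rdisj Rline AR BR CR AB AC BC.
have cap0 (X Y : {vspace V}) (x : V) : X \in R -> Y \in R -> X != Y -> x \in X -> x \in Y -> x = 0.
  move=> XR YR XY xX xY; apply/eqP; rewrite -memv0 -(Rdisj X Y) //.
  by rewrite memv_cap xX.
have [-> | t0] := eqVneq t 0.
  by exists A => // a b aA _ _; rewrite scale0r addr0.
have b_eq0 a b : a \in A -> b \in B -> a + b \in C -> a = 0 -> b = 0.
  by move=> aA bB + a0; rewrite a0 add0r; apply: (cap0 B C).
have a_eq0 a b : a \in A -> b \in B -> a + b \in C -> b = 0 -> a = 0.
  by move=> aA bB + b0; rewrite b0 addr0; apply: (cap0 A C).
have line a b : a \in A -> b \in B -> a + b \in C -> a != 0 ->
    [/\ forall U, U \in R -> exists s r : F, s *: a + r *: b \in U /\ s *: a + r *: b != 0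
      & exists2 U, U \in R & a + t *: b \in U].
  move=> aA bB abC a0; have b0 : b != 0 by apply: contraNneq a0 => b_0; rewrite (a_eq0 a b).
  have ba : b \notin <[a]>%VS.
    apply: contraNN b0 => /vlineP[s bE]; apply/eqP/(cap0 A B b) => //.
    by rewrite bE memvZ.
  pose l := (<[a]> + <[b]>)%VS.
  have al : a \in l by rewrite memvE addvSl.
  have bl : b \in l by rewrite memvE addvSr.
  have meet (x : V) (X : {vspace V}) : x != 0 -> x \in l -> x \in X -> (l :&: X != 0)%VS.
    by move=> x0 xl xX; apply: contraNneq x0 => E; rewrite -memv0 -E memv_cap xl.
  have ab0 : a + b != 0.
    apply: contraNneq a0 => /eqP; rewrite addr_eq0 => /eqP aE.
    by apply/eqP/(cap0 A B) => //; rewrite aE memvN.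
  have lW : (l <= W)%VS.
    by rewrite subv_add -!memvE (subvP (RW _ AR).1) // (subvP (RW _ BR).1).
  have [h1 h2] := Rline l A B C (dim_span2 a0 ba) lW AR BR CR AB AC BC
    (meet a A a0 al aA) (meet b B b0 bl bB) (meet (a + b) C ab0 (memvD al bl) abC).
  split=> [U /h1 lU|].
    have /memv_capP[] := memv_pick (l :&: U).
    move=> /memv_addP[_ /vlineP[s ->] [_ /vlineP[r ->] E]] xU.
    by exists s, r; rewrite -E xU vpick0.
  have abt0 : a + t *: b != 0.
    apply: contraNneq a0 => /eqP; rewrite addr_eq0 => /eqP aE.
    by apply/eqP/(cap0 A B) => //; rewrite aE memvN memvZ.
  have [||U UR Pt] := h2 <[a + t *: b]>%VS; first by rewrite dim_vline abt0.
    by rewrite -memvE memvD ?memvZ.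
  by exists U; rewrite // memvE.
(* Without a nonzero pair any member works, and [A] is taken. *)
have [E0 | nz] := eqVneq (A :&: (B + C))%VS 0%VS.
  exists A => // a b aA bB abC.
  have a0 : a = 0.
    apply/eqP; rewrite -memv0 -E0 memv_cap aA -[a](addrK b) addrC.
    by rewrite memv_add ?memvN.
  by rewrite (b_eq0 a b) // a0 scaler0 addr0 mem0v.
pose a0 := vpick (A :&: (B + C)).
have a0_neq0 : a0 != 0 by rewrite vpick0.
have /memv_capP[a0A /memv_addP[b' b'B [c cC a0E]]] := memv_pick (A :&: (B + C)).
pose b0 := - b'; have b0B : b0 \in B by rewrite memvN.
have ab0C : a0 + b0 \in C by rewrite [a0]a0E addrC addKr.
have [_ [U UR U0]] := line a0 b0 a0A b0B ab0C a0_neq0.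
exists U => // a b aA bB abC.
have AU : A != U.
  apply: contraNneq a0_neq0 => AU; apply/eqP/(a_eq0 a0 b0) => //.
  apply: (cap0 A B) => //; move: U0; rewrite -AU => /(memvB)/(_ a0A).
  by rewrite addrC addKr => /(memvZ t^-1); rewrite scalerA mulVf // scale1r.
have BU : B != U.
  apply: contraNneq a0_neq0 => BU; apply/eqP/(cap0 A B) => //.
  by move: U0; rewrite -BU => /memvB/(_ (memvZ t b0B)); rewrite addrK.
have [a_0 | a_neq0] := eqVneq a 0.
  by rewrite (b_eq0 a b) // a_0 scaler0 addr0 mem0v.
have get x y : x \in A -> y \in B -> x + y \in C -> x != 0 ->
    exists r : F, x + r *: y \in U.
  move=> xA yB xyC x0; have [/(_ U UR)[s [r [srU sr0]]] _] := line x y xA yB xyC x0.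
  have s0 : s != 0.
    apply: contraNneq sr0 => s0; move: srU; rewrite s0 scale0r add0r => rU.
    by apply/eqP/(cap0 B U) => //; apply: memvZ.
  exists (s^-1 * r); have := memvZ s^-1 srU.
  by rewrite scalerDr !scalerA mulVf // scale1r.
have [r rU] := get a b aA bB abC a_neq0.
have [aa0 | aa0] := eqVneq (a + a0) 0.
  have bb0 : b + b0 = 0.
    apply: (b_eq0 (a + a0)) => //; [exact: memvD | exact: memvD |].
    by rewrite addrACA memvD.
  move/eqP: aa0; rewrite addr_eq0 => /eqP->; move/eqP: bb0; rewrite addr_eq0 => /eqP->.
  by rewrite scalerN -opprD memvN.
have [r' r'U] : exists r', (a + a0) + r' *: (b + b0) \in U.
  by apply: get; [exact: memvD | exact: memvD | rewrite addrACA memvD |].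
have [<- // | rt] := eqVneq r t.
(* The member [U] contains [a0 + t b0], [a + r b] and the point of parameter [r'] for the sum;
   subtracting leaves a vector of [B] in [U]. As [r != t], the vectors [b] and [b0] are
   proportional, hence so are the two pairs. *)
have E : (r' - r) *: b + (r' - t) *: b0 = 0.
  apply: (cap0 B U) => //; first by rewrite memvD ?memvZ.
  have := memvB (memvB r'U rU) U0; congr (_ \in U).
  rewrite [r' *: _]scalerDr [a + a0 + _]addrACA -[LHS]addrA addrACA !scalerBl.
  by rewrite [a + r' *: b]addrC [a0 + r' *: b0]addrC !addrKA.
have [r't | r't] := eqVneq r' t.
  move: E; rewrite r't subrr scale0r addr0 => /eqP; rewrite scaler_eq0 subr_eq0 eq_sym (negPf rt) /=.
  by move/eqP/(a_eq0 a b aA bB abC) => a_0; rewrite a_0 eqxx in a_neq0.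
pose z := - ((r' - r) / (r' - t)).
have b0E : b0 = z *: b.
  have d0 : r' - t != 0 by rewrite subr_eq0.
  apply: (scalerI d0); rewrite scalerA mulrN mulrCA mulfV // mulr1 scaleNr.
  by apply/eqP; rewrite -addr_eq0 addrC E.
have a0E' : a0 = z *: a.
  apply/eqP; rewrite -subr_eq0; apply/eqP/(cap0 A C) => //; first by rewrite memvB ?memvZ.
  have := memvB ab0C (memvZ z abC); congr (_ \in C).
  by rewrite scalerDr b0E opprD addrACA subrr addr0.
have z0 : z != 0 by apply: contraNneq a0_neq0 => z0; rewrite a0E' z0 scale0r.
move: U0; rewrite a0E' b0E scalerA mulrC -scalerA -scalerDr => /(memvZ z^-1).
by rewrite scalerA mulVf // scale1r.
Qed.
End Reguli.

(** * Generalized arcs and their quotients *)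

Section Arcs.

Variables (F : finFieldType) (n k : nat) (pi : 'I_k -> {vspace 'rV[F]_(3 * n)}).
Hypotheses (k_gt2 : (2 < k)%N) (arc : generalized_arc pi).

Lemma arc_dim i : \dim (pi i) = n.
Proof. by case: arc. Qed.

Lemma third_index (i j : 'I_k) : exists l, i != l /\ j != l.
Proof.
have [l] : exists l, l \in ~: [set i; j].
  apply/card_gt0P; rewrite -(ltn_add2l #|[set i; j]|) cardsC addn0 card_ord.
  by apply: leq_ltn_trans k_gt2; rewrite cards2; case: (i != j).
by rewrite !inE negb_or => /andP[? ?]; exists l; rewrite ![_ == l]eq_sym.
Qed.

Lemma arc_dim3 i j l : i != j -> i != l -> j != l -> \dim (pi i + pi j + pi l) = (3 * n)%N.
Proof. by case: arc => _ _ h ij il jl; rewrite h // dim_rV. Qed.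

Lemma arc_dim2 i j : i != j -> \dim (pi i + pi j) = (2 * n)%N.
Proof.
move=> ij; have [l [il jl]] := third_index i j.
have := arc_dim3 ij il jl.
have := dimv_sum_cap (pi i) (pi j); have := dimv_sum_cap (pi i + pi j) (pi l).
rewrite !arc_dim; lia.
Qed.

Lemma arc_cap3 i j l : i != j -> i != l -> j != l -> ((pi i + pi j) :&: pi l = 0)%VS.
Proof.
move=> ij il jl; apply/eqP; rewrite -dimv_eq0; apply/eqP.
have := arc_dim3 ij il jl; have := arc_dim2 ij.
by have := dimv_sum_cap (pi i + pi j) (pi l); rewrite !arc_dim; lia.
Qed.

Lemma arc_cap2 i j : i != j -> (pi i :&: pi j = 0)%VS.
Proof.
move=> ij; apply/eqP; rewrite -dimv_eq0; apply/eqP.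
by have := dimv_sum_cap (pi i) (pi j); rewrite !arc_dim arc_dim2 //; lia.
Qed.

Lemma arc_cap_pencil i j l : i != j -> i != l -> j != l ->
  ((pi i + pi j) :&: (pi i + pi l) = pi i)%VS.
Proof.
move=> ij il jl; apply/esym/eqP; rewrite eqEdim subv_cap !addvSl arc_dim /=.
have := dimv_sum_cap (pi i + pi j) (pi i + pi l); rewrite !arc_dim2 //.
have -> : \dim (pi i + pi j + (pi i + pi l)) = (3 * n)%N.
  by rewrite addvA -(addvA (pi i)) (addvC (pi j)) addvA addvv arc_dim3.
lia.
Qed.

Lemma arc_indep i j l x y z : i != j -> i != l -> j != l ->
  x \in pi i -> y \in pi j -> z \in pi l -> x + y + z = 0 -> [/\ x = 0, y = 0 & z = 0].
Proof.
move=> ij il jl xi yj zl /eqP; rewrite addr_eq0 => /eqP xyE.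
have z0 : z = 0.
  apply/eqP; rewrite -memv0 -(arc_cap3 ij il jl) memv_cap zl andbT.
  by rewrite -[z]opprK memvN -xyE memv_add.
move: xyE; rewrite z0 oppr0 => /eqP; rewrite addr_eq0 => /eqP xE.
have y0 : y = 0.
  apply/eqP; rewrite -memv0 -(arc_cap2 ij) memv_cap yj andbT.
  by rewrite -[y]opprK memvN -xE.
by rewrite xE y0 oppr0.
Qed.

Lemma arc_complement (W : {vspace 'rV[F]_(3 * n)}) i :
    \dim W = (2 * n)%N -> (W :&: pi i = 0)%VS ->
  forall v, exists2 w, w \in W & v - w \in pi i.
Proof.
move=> dW W0 v; have : v \in (W + pi i)%VS.
  suffices -> : (W + pi i)%VS = fullv by rewrite memvf.
  apply/eqP; rewrite eqEdim subvf dim_rV dimv_disjoint_sum // dW arc_dim; lia.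
by case/memv_addP=> w wW [u ui ->]; exists w; rewrite // addrC addKr.
Qed.

(* Closure under reguli of the spread induced in the quotient by [pi i]. *)
Definition regular_at i : Prop :=
  forall j l m (t : F), j != i -> l != i -> m != i -> j != l -> j != m -> l != m ->
  exists2 r, r != i &
    forall a b, a \in (pi j + pi i)%VS -> b \in (pi l + pi i)%VS ->
      a + b \in (pi m + pi i)%VS -> a + t *: b \in (pi r + pi i)%VS.

(** Replacing a vector by its representative in [W] modulo [pi i] does not affect membership in
    [pi r + pi i], so the complement disappears from the conclusion. *)
Lemma regular_spread_at (W : {vspace 'rV[F]_(3 * n)}) i : (0 < n)%N ->
    \dim W = (2 * n)%N -> (W :&: pi i = 0)%VS ->
    regular_spread n W (projected_spread pi i W) -> regular_at i.
Proof.
move=> n0 dW W0 [[Sdim _ _] Sreg] j l m t ji li mi jl jm lm.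
pose S r := ((pi i + pi r) :&: W)%VS.
have SP r : r != i -> S r \in projected_spread pi i W.
  by move=> ri; apply: image_f; rewrite inE.
have S_neq r s : r != i -> s != i -> r != s -> S r != S s.
  move=> ri si rs; apply: contraTneq n0 => E; rewrite -(Sdim _ (SP r ri)).2.
  suffices -> : S r = 0%VS by rewrite dimv0.
  apply/eqP; rewrite -subv0 -W0 -[in X in (_ <= X)%VS](arc_cap_pencil _ _ rs) 1?eq_sym //.
  rewrite capvC subv_cap capvSr andbT subv_cap capvSl /=.
  by rewrite E capvSl.
have [R [Rreg [jR lR mR] RS]] :=
  Sreg _ _ _ (SP j ji) (SP l li) (SP m mi) (S_neq _ _ ji li jl) (S_neq _ _ ji mi jm) (S_neq _ _ li mi lm).
have [U UR Ut] := regulus_transversal t Rreg jR lR mR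
  (S_neq _ _ ji li jl) (S_neq _ _ ji mi jm) (S_neq _ _ li mi lm).
have /imageP[r ri UE] := RS _ UR; rewrite inE in ri.
exists r => // a b aj bl abm.
have [a' a'W a'i] := arc_complement dW W0 a.
have [b' b'W b'i] := arc_complement dW W0 b.
have inS x x' s : x' \in W -> x - x' \in pi i -> x \in (pi s + pi i)%VS -> x' \in S s.
  move=> x'W xi xs; rewrite memv_cap x'W andbT addvC -[x'](subKr x).
  by rewrite memvB // (subvP (addvSr _ _)).
have : a' + t *: b' \in U.
  apply: Ut; [exact: inS aj | exact: inS bl |].
  apply: (inS (a + b)) => //; first by rewrite memvD.
  by rewrite opprD addrACA memvD.
rewrite UE memv_cap => /andP[a'b' _]; rewrite addvC.
rewrite -[a](subrK a') -[b](subrK b') scalerDr addrACA memvD //.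
by rewrite (subvP (addvSl _ _)) // memvD ?memvZ.
Qed.

End Arcs.

(** * Row spaces, frames and the spread sets seen from an element *)

Section RowSpan.

Variables (F : fieldType) (m n : nat).
Implicit Types (P : 'M[F]_(m, n)).

Definition rowspan P : {vspace 'rV[F]_n} := limg (linfun (mulmxr P : 'rV_m -> 'rV_n)).

Lemma rowspanP P v : reflect (exists x : 'rV_m, v = x *m P) (v \in rowspan P).
Proof.
apply: (iffP memv_imgP) => [[x _ ->] | [x ->]]; first by exists x; rewrite lfunE.
by exists x; rewrite ?memvf // lfunE.
Qed.

Lemma mem_rowspan P (x : 'rV_m) : x *m P \in rowspan P.
Proof. by apply/rowspanP; exists x. Qed.

Lemma rowspan_sub P (U : {vspace 'rV[F]_n}) :
  reflect (forall x : 'rV_m, x *m P \in U) (rowspan P <= U)%VS.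
Proof.
apply: (iffP subvP) => [h x | h _ /rowspanP[x ->] //].
exact/h/mem_rowspan.
Qed.

Lemma rowspan_inj P (x : 'rV_m) : \dim (rowspan P) = m -> x *m P = 0 -> x = 0.
Proof.
move=> dP xP; have := limg_ker_dim (linfun (mulmxr P : 'rV_m -> 'rV_n)) fullv.
rewrite -/(rowspan P) dP dim_rV capfv => /eqP; rewrite -[X in _ == X]add0n eqn_add2r.
rewrite dimv_eq0 => /lker0P inj; apply: inj.
by rewrite !lfunE /= xP mul0mx.
Qed.

Lemma vspace_rowspan (U : {vspace 'rV[F]_n}) : \dim U = m -> exists P, U = rowspan P.
Proof.
move=> dU; have Ub := vbasisP U; have sz : size (vbasis U) = m by rewrite size_tuple.
exists (\matrix_(i < m) (vbasis U)`_i); apply/vspaceP => v.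
apply/idP/rowspanP => [vU | [x ->]].
  exists (\row_i coord (vbasis U) (cast_ord (esym dU) i) v).
  rewrite mulmx_sum_row {1}(coord_vbasis vU) (reindex (cast_ord (esym dU))) /=.
    by apply: eq_bigr => i _; rewrite rowK mxE.
  by exists (cast_ord dU) => i _; rewrite ?cast_ordK ?cast_ordKV.
rewrite mulmx_sum_row memv_suml // => i _; rewrite rowK memvZ // vbasis_mem //.
by rewrite mem_nth // sz.
Qed.

End RowSpan.

Lemma rowspan_unit (F : fieldType) m n (A : 'M[F]_m) (P : 'M_(m, n)) :
  A \in unitmx -> rowspan (A *m P) = rowspan P.
Proof.
move=> Au; apply/eqP; rewrite eqEsubv; apply/andP; split; apply/rowspan_sub => x.
  by rewrite mulmxA mem_rowspan.
by rewrite -[x](mulmxKV Au) -(mulmxA _ A) mem_rowspan.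
Qed.

Section Frames.

Variables (F : finFieldType) (n' k : nat).
Local Notation n := n'.+1.
Variable pi : 'I_k -> {vspace 'rV[F]_(3 * n)}.
Hypotheses (k_gt2 : (2 < k)%N) (arc : generalized_arc pi).
Local Notation mx := 'M[F]_(n, 3 * n).

Section Frame.

Variables (a b c : 'I_k) (Pa Pb Pc : mx).
Hypotheses (ab : a != b) (ac : a != c) (bc : b != c).
Hypotheses (pia : pi a = rowspan Pa) (pib : pi b = rowspan Pb) (pic : pi c = rowspan Pc).

Lemma frame_indep (x y z : 'rV_n) : x *m Pa + y *m Pb + z *m Pc = 0 -> [/\ x = 0, y = 0 & z = 0].
Proof.
case/(arc_indep k_gt2 arc ab ac bc); rewrite ?pia ?pib ?pic ?mem_rowspan //.
have dims : [/\ \dim (rowspan Pa) = n, \dim (rowspan Pb) = n & \dim (rowspan Pc) = n].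
  by rewrite -pia -pib -pic !(arc_dim arc).
by case: dims => da db dc /(rowspan_inj da)-> /(rowspan_inj db)-> /(rowspan_inj dc)->.
Qed.

Lemma frame_span (Q : mx) : exists A B C : 'M_n, Q = A *m Pa + B *m Pb + C *m Pc.
Proof.
have row_ex i : exists x : 'rV_n * 'rV_n * 'rV_n,
    row i Q = x.1.1 *m Pa + x.1.2 *m Pb + x.2 *m Pc.
  have : row i Q \in (pi a + pi b + pi c)%VS.
    by case: arc => _ _ -> //; rewrite memvf.
  case/memv_addP=> _ /memv_addP[u + [v + ->]] [w + ->].
  rewrite pia pib pic => /rowspanP[x ->] /rowspanP[y ->] /rowspanP[z ->].
  by exists (x, y, z).
have [f fE] := fin_all_exists row_ex.
exists (\matrix_i (f i).1.1), (\matrix_i (f i).1.2), (\matrix_i (f i).2).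
by apply/row_matrixP => i; rewrite fE !linearD /= !row_mul !rowK.
Qed.

(** A coefficient with a kernel would put a nonzero vector of [pi j] in the sum of two frame
    elements. Left multiplication by an invertible matrix keeps the row space, so the last
    coefficient can be made 1. *)
Lemma frame_coord j : j != a -> j != b -> j != c ->
  exists A B : 'M_n, [/\ A \is a GRing.unit, B \is a GRing.unit
    & pi j = rowspan (A *m Pa + B *m Pb + Pc)].
Proof.
move=> ja jb jc; have [Q jQ] := vspace_rowspan (arc_dim arc j).
have [A [B [C QE]]] := frame_span Q.
have dQ : \dim (rowspan Q) = n by rewrite -jQ (arc_dim arc).
have unit (r s : 'I_k) (X : 'M_n) : j != r -> j != s -> r != s ->
    (forall x, x *m X = 0 -> x *m Q \in (pi r + pi s)%VS) -> X \is a GRing.unit.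
  move=> jr js rs h; apply: unitmxP_row => x /h xQ; apply: (rowspan_inj dQ).
  have [rj sj] : r != j /\ s != j by rewrite ![_ == j]eq_sym.
  apply/eqP; rewrite -memv0 -(arc_cap3 k_gt2 arc rs rj sj).
  by rewrite memv_cap xQ jQ mem_rowspan.
have Cu : C \is a GRing.unit.
  apply: (unit a b) => // x xC; rewrite QE !mulmxDr !mulmxA xC mul0mx addr0.
  by rewrite pia pib memv_add ?mem_rowspan.
have Au : A \is a GRing.unit.
  apply: (unit b c) => // x xC; rewrite QE !mulmxDr !mulmxA xC mul0mx add0r.
  by rewrite pic pib memv_add ?mem_rowspan.
have Bu : B \is a GRing.unit.
  apply: (unit a c) => // x xC; rewrite QE !mulmxDr !mulmxA xC mul0mx addr0.
  by rewrite pic pia memv_add ?mem_rowspan.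
exists (C^-1 * A), (C^-1 * B); split; rewrite ?unitrMr ?unitrV //.
rewrite jQ QE -(rowspan_unit _ (_ : C^-1 \in unitmx)) ?unitrV //; congr rowspan.
by rewrite !mulmxDr !mulmxA [_ *m C]mulVr // mul1mx.
Qed.

End Frame.

(** The coefficients of [pi d] are absorbed into [Pa] and [Pb], which makes [d] the unit element of
    the frame. *)
Lemma arc_frame a b c d : a != b -> a != c -> b != c -> d != a -> d != b -> d != c ->
  exists Pa Pb Pc : mx, [/\ pi a = rowspan Pa, pi b = rowspan Pb, pi c = rowspan Pc
    & pi d = rowspan (Pa + Pb + Pc)].
Proof.
move=> ab ac bc da db dc.
have [Pa aE] := vspace_rowspan (arc_dim arc a).
have [Pb bE] := vspace_rowspan (arc_dim arc b).
have [Pc cE] := vspace_rowspan (arc_dim arc c).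
have [A [B [Au Bu dE]]] := frame_coord ab ac bc aE bE cE da db dc.
by exists (A *m Pa), (B *m Pb), Pc; rewrite !rowspan_unit.
Qed.

(** The spread set of the quotient by [pi a] with [pi b] at infinity: there [pi j] is the graph of
    [M]. In the frames used below [c] has matrix 0 and [d] has matrix 1. *)
Definition pencil_set a b (Pb Pc : mx) : {set 'M[F]_n} :=
  [set M | [exists j, [&& j != a, j != b & (rowspan (M *m Pb + Pc) <= pi j + pi a)%VS]]].

Lemma pencil_setP a b (Pb Pc : mx) M :
  reflect (exists j, [/\ j != a, j != b & forall y : 'rV_n, y *m M *m Pb + y *m Pc \in (pi j + pi a)%VS])
    (M \in pencil_set a b Pb Pc).
Proof.
rewrite inE; apply: (iffP existsP) => -[j].
  case/and3P=> ja jb /rowspan_sub h; exists j; split=> // y.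
  by rewrite -mulmxA -mulmxDr h.
case=> ja jb h; exists j; rewrite ja jb; apply/rowspan_sub => y.
by rewrite mulmxDr mulmxA h.
Qed.

Section PencilSet.

Variables (a b c d : 'I_k) (Pa Pb Pc : mx).
Hypotheses (ab : a != b) (ac : a != c) (bc : b != c).
Hypotheses (da : d != a) (db : d != b) (dc : d != c).
Hypotheses (pia : pi a = rowspan Pa) (pib : pi b = rowspan Pb) (pic : pi c = rowspan Pc).
Hypothesis pid : pi d = rowspan (Pa + Pb + Pc).
Hypotheses (k_card : k = (#|F| ^ n + 2)%N) (rega : regular_at pi a).
Let S := pencil_set a b Pb Pc.

(** In the quotient by [pi a] the image of [pi j] meets that of [pi b] trivially, so [j] determines
    [M]; it meets that of another [pi l] trivially, so [M - N] has no kernel. The vector [y] is a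
    dummy for the first half. *)
Lemma pencil_unique j l (M N : 'M_n) (y : 'rV_n) : j != a -> j != b -> l != a -> l != b ->
    (forall y : 'rV_n, y *m M *m Pb + y *m Pc \in (pi j + pi a)%VS) ->
    (forall y : 'rV_n, y *m N *m Pb + y *m Pc \in (pi l + pi a)%VS) ->
  (j = l -> M = N) /\ (j != l -> y *m (M - N) = 0 -> y = 0).
Proof.
move=> ja jb la lb hM hN; split=> [jl | jl yMN].
  rewrite -jl in hN.
  apply/eqP; rewrite -subr_eq0; apply/eqP/row_matrixP => i; rewrite row0 rowE.
  set e := delta_mx 0 i; have := memvB (hM e) (hN e).
  rewrite opprD addrACA subrr addr0 -!mulmxBl -mulmxBr => h.
  suffices : e *m (M - N) *m Pb = 0 by apply: rowspan_inj; rewrite -pib (arc_dim arc).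
  apply/eqP; rewrite -memv0 -(arc_cap3 k_gt2 arc ja jb ab) memv_cap h.
  by rewrite pib mem_rowspan.
have yE : y *m M = y *m N by apply/eqP; rewrite -subr_eq0 -mulmxBr yMN.
have : y *m M *m Pb + y *m Pc \in pi a.
  have [aj al] : a != j /\ a != l by rewrite ![a == _]eq_sym.
  rewrite -(arc_cap_pencil k_gt2 arc aj al jl).
  by rewrite memv_cap ![(pi a + _)%VS]addvC hM yE hN.
rewrite pia => /rowspanP[x E].
suff /(frame_indep ab ac bc pia pib pic)[] :
  (- x) *m Pa + y *m M *m Pb + y *m Pc = 0 by [].
by rewrite mulNmx -E -addrA addNr.
Qed.

Lemma pencil_set_regular : regular_spread_set S.
Proof.
have addCBA (u v w : 'rV[F]_(3 * n)) : u + v + w - u = v + w.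
  by rewrite -(addrA u) (addrC u) addrK.
have inl j x : x \in pi j -> x \in (pi j + pi a)%VS by apply/subvP/addvSl.
have inr j x : x \in pi a -> x \in (pi j + pi a)%VS by apply/subvP/addvSr.
have notb (z : 'rV_n) : z *m Pc \in (pi b + pi a)%VS -> z = 0.
  move=> h; suffices : z *m Pc = 0 by apply: rowspan_inj; rewrite -pic (arc_dim arc).
  apply/eqP; rewrite -memv0 -(arc_cap3 k_gt2 arc _ bc ac) 1?eq_sym //.
  by rewrite memv_cap h pic mem_rowspan.
have e0 : delta_mx 0 0 != 0 :> 'rV[F]_n.
  by apply/eqP => /matrixP/(_ 0 0); rewrite !mxE eqxx => /eqP; rewrite oner_eq0.
have pb_in (y : 'rV_n) : y *m Pb \in (pi b + pi a)%VS.
  by rewrite (subvP (addvSl _ _)) // pib mem_rowspan.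
have r_neq_b r M : (forall y : 'rV_n, y *m M *m Pb + y *m Pc \in (pi r + pi a)%VS) -> r != b.
  move=> h; apply: contraNneq e0 => rb; rewrite rb in h; apply/eqP/notb.
  have := memvB (h (delta_mx 0 0)) (pb_in (delta_mx 0 0 *m M)).
  by rewrite [X in X - _]addrC addrK.
have h0 (y : 'rV_n) : y *m (0 : 'M_n) *m Pb + y *m Pc \in (pi c + pi a)%VS.
  by rewrite mulmx0 mul0mx add0r (subvP (addvSl _ _)) // pic mem_rowspan.
have h1 (y : 'rV_n) : y *m (1 : 'M_n) *m Pb + y *m Pc \in (pi d + pi a)%VS.
  have -> : y *m (1 : 'M_n) *m Pb + y *m Pc = y *m (Pa + Pb + Pc) - y *m Pa.
    by rewrite mulmx1 !mulmxDr addCBA.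
  by apply: memvB; [apply: inl; rewrite pid | apply: inr; rewrite pia]; apply: mem_rowspan.
have S0 : 0 \in S by apply/pencil_setP; exists c; rewrite eq_sym ac eq_sym bc.
have S1 : 1 \in S by apply/pencil_setP; exists d.
have affS t : {in S &, forall M N, M + t *: (N - M) \in S}.
  move=> M N MS NS; have [-> | MN] := eqVneq M N; first by rewrite subrr scaler0 addr0.
  have /pencil_setP[j [ja jb hM]] := MS; have /pencil_setP[l [la lb hN]] := NS.
  have jl : j != l by apply: contraNneq MN => /(pencil_unique 0 ja jb la lb hM hN).1->.
  (* The regulus through [j], infinity and [l]: the vectors of [j] and [l] over the same [y] differ
     by [y *m (N - M) *m Pb], which lies in [pi b]. *)
  have [||r ra hr] := rega t ja _ la jb jl _; [by rewrite eq_sym | by rewrite eq_sym |].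
  have hy (y : 'rV_n) : y *m (M + t *: (N - M)) *m Pb + y *m Pc \in (pi r + pi a)%VS.
    have := hr _ _ (hM y) (pb_in (y *m (N - M))).
    have -> : y *m M *m Pb + y *m Pc + y *m (N - M) *m Pb = y *m N *m Pb + y *m Pc.
      by rewrite mulmxBr mulmxBl addrAC [X in X + _]addrC subrK.
    by move/(_ (hN y)); rewrite addrAC (mulmxDr y M) (mulmxDl (y *m M)) -scalemxAr -scalemxAl.
  by apply/pencil_setP; exists r; split=> //; apply: r_neq_b hy.
split=> //.
- move=> M N MS NS MN; have /pencil_setP[j [ja jb hM]] := MS; have /pencil_setP[l [la lb hN]] := NS.
  have jl : j != l by apply: contraNneq MN => /(pencil_unique 0 ja jb la lb hM hN).1->.
  by apply: unitmxP_row => y; apply: (pencil_unique y ja jb la lb hM hN).2.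
- move=> t M MS; set M' := 1 + _ => M'0.
  have M'S : M' \in S by apply: affS.
  have [-> | M0] := eqVneq M 0; first by rewrite mulr0.
  have [M1 | M1] := eqVneq M 1.
    by rewrite /M' M1 subrr scaler0 addr0 invr1 mulr1.
  have M'u : M' \in unitmx.
    rewrite -[M']subr0; have /pencil_setP[j [ja jb hM]] := M'S.
    have jc : j != c.
      apply: contraNneq M'0 => jc; apply/eqP.
      by apply: (pencil_unique 0 ja jb _ _ hM h0).1; rewrite // eq_sym.
    apply: unitmxP_row => y; apply: (pencil_unique y ja jb _ _ hM h0).2 => //.
      by rewrite eq_sym.
    by rewrite eq_sym.
  have /pencil_setP[j [ja jb hM]] := MS.
  have jc : j != c.
    apply: contraNneq M0 => jc; apply/eqP.
    by apply: (pencil_unique 0 ja jb _ _ hM h0).1; rewrite // eq_sym.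
  have jd : j != d.
    by apply: contraNneq M1 => jd; apply/eqP/(pencil_unique 0 ja jb da db hM h1).1.
  (* The regulus through [j], 0 and 1: adding [z *m (M - 1) *m Pc] to the vector of [j] over [z]
     gives the vector of [d] over [z *m M]. With factor [t] instead, the coefficient of [Pc] is
     [z *m M'], which [z = y *m M'^-1] normalizes to [y]. *)
  have [||r ra hr] := rega t ja _ da jc jd _; [by rewrite eq_sym | by rewrite eq_sym|].
  have hy (y : 'rV_n) : y *m (M'^-1 * M) *m Pb + y *m Pc \in (pi r + pi a)%VS.
    pose z := y *m M'^-1.
    have zM'E : z *m M' = y by rewrite mulmxKV.
    have zc : z *m (M - 1) *m Pc \in (pi c + pi a)%VS by apply: inl; rewrite pic mem_rowspan.
    have := hr _ _ (hM z) zc.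
    have -> : z *m M *m Pb + z *m Pc + z *m (M - 1) *m Pc
        = z *m M *m (1 : 'M_n) *m Pb + z *m M *m Pc.
      by rewrite !mulmx1 mulmxBr mulmxBl mulmx1 -addrA [X in _ + X]addrC subrK.
    move=> /(_ (h1 _)).
    suffices -> : z *m M *m Pb + z *m Pc + t *: (z *m (M - 1) *m Pc)
        = y *m (M'^-1 * M) *m Pb + y *m Pc by [].
    rewrite mulmxA -/z -addrA; congr (_ + _).
    by rewrite scalemxAl scalemxAr -mulmxDl -[X in (X + _) *m _]mulmx1 -mulmxDr zM'E.
  by apply/pencil_setP; exists r; split=> //; apply: r_neq_b hy.
(* Each of the [q^n] indices other than [a] and [b] has its own matrix, which counts [S]. The 0 at
   [a] and [b] is a filler, the 0 at [c] is genuine. *)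
have ex j : exists M : 'M_n, j != a -> j != b ->
    forall y : 'rV_n, y *m M *m Pb + y *m Pc \in (pi j + pi a)%VS.
  have [-> | jc] := eqVneq j c; first by exists 0.
  have [-> | ja] := eqVneq j a; first by exists 0.
  have [-> | jb] := eqVneq j b; first by exists 0.
  have [A [B [_ _ jE]]] := frame_coord ab ac bc pia pib pic ja jb jc.
  exists B => _ _ y.
  have -> : y *m B *m Pb + y *m Pc = y *m (A *m Pa + B *m Pb + Pc) - y *m A *m Pa.
    by rewrite !mulmxDr !mulmxA addCBA.
  by apply: memvB; [apply: inl; rewrite jE | apply: inr; rewrite pia]; apply: mem_rowspan.
have [f hf] := fin_all_exists ex.
have -> : S = f @: ~: [set a; b].
  apply/setP => M; apply/pencil_setP/imsetP => [[j [ja jb hM]] | [j]].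
    exists j; rewrite ?inE ?negb_or ?ja //.
    exact: (pencil_unique 0 ja jb ja jb hM (hf j ja jb)).1.
  by rewrite !inE negb_or => /andP[ja jb] ->; exists j; split=> //; apply: hf.
rewrite card_in_imset => [|j l].
  apply/eqP; rewrite -(eqn_add2l #|[set a; b]|) cardsC card_ord cards2 ab k_card.
  by rewrite addnC.
rewrite !inE !negb_or => /andP[ja jb] /andP[la lb] fE; apply/eqP.
apply: contraNT e0 => jl; apply/eqP.
apply: (pencil_unique _ ja jb la lb (hf j ja jb) (hf l la lb)).2 => //.
by rewrite fE subrr mulmx0.
Qed.

End PencilSet.
End Frames.

Lemma eq_row_mul (F : fieldType) m n (X Y : 'M[F]_(m, n)) :
  (forall x : 'rV_m, x *m X = x *m Y) -> X = Y.
Proof. by move=> h; apply/row_matrixP => i; rewrite !rowE h. Qed.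

(** * One field for all elements of the arc *)

Section CommonField.

Variables (F : finFieldType) (n' k : nat).
Local Notation n := n'.+1.
Variable pi : 'I_k -> {vspace 'rV[F]_(3 * n)}.
Hypotheses (q_gt2 : (2 < #|F|)%N) (n_pr : prime n) (k_card : k = (#|F| ^ n + 2)%N).
Hypotheses (arc : generalized_arc pi) (reg : forall i, regular_at pi i).
Local Notation mx := 'M[F]_(n, 3 * n).

Lemma exists_four : exists a b c d : 'I_k,
  [/\ a != b, a != c & b != c] /\ [/\ d != a, d != b & d != c].
Proof.
have k4 : (3 < k)%N.
  rewrite k_card addn2 !ltnS; apply: leq_trans (ltnW q_gt2) _.
  by rewrite -[X in (X <= _)%N]expn1 leq_exp2l // ltnW.
exists (Ordinal (ltnW (ltnW (ltnW k4)))), (Ordinal (ltnW (ltnW k4))), (Ordinal (ltnW k4)), (Ordinal k4).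
by [].
Qed.

Theorem arc_common_field : exists (Pa Pb Pc : mx) (M : 'M_n),
  [/\ irreducible_poly (mxminpoly M), degree_mxminpoly M = n
    & forall j, exists A B C : 'M_n,
        [/\ A \in mx_poly_span M, B \in mx_poly_span M, C \in mx_poly_span M
          & pi j = rowspan (A *m Pa + B *m Pb + C *m Pc)]].
Proof.
have k_gt2 : (2 < k)%N by rewrite k_card addn2 !ltnS expn_gt0 (ltnW (ltnW q_gt2)).
have [a [b [c [d [[ab ac bc] [da db dc]]]]]] := exists_four.
have [ba [ca cb]] : b != a /\ c != a /\ c != b by rewrite ![_ == a]eq_sym [c == b]eq_sym.
have [Pa [Pb [Pc [pia pib pic pid]]]] := arc_frame k_gt2 arc ab ac bc da db dc.
have indep := frame_indep k_gt2 arc ab ac bc pia pib pic.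
pose P j := [/\ j != a, j != b & j != c].
have ex j : exists AB : 'M[F]_n * 'M[F]_n, P j ->
    [/\ AB.1 \is a GRing.unit, AB.2 \is a GRing.unit
      & pi j = rowspan (AB.1 *m Pa + AB.2 *m Pb + Pc)].
  have [ja | ja] := eqVneq j a; first by exists (0, 0) => -[]; rewrite ja eqxx.
  have [jb | jb] := eqVneq j b; first by exists (0, 0) => -[]; rewrite jb eqxx.
  have [jc | jc] := eqVneq j c; first by exists (0, 0) => -[]; rewrite jc eqxx.
  have [A [B h]] := frame_coord k_gt2 arc ab ac bc pia pib pic ja jb jc.
  by exists (A, B).
have [AB hAB] := fin_all_exists ex.
pose A j := (AB j).1; pose B j := (AB j).2.
have Au j (Pj : P j) : A j \is a GRing.unit by case: (hAB j Pj).
have Bu j (Pj : P j) : B j \is a GRing.unit by case: (hAB j Pj).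
have jE j (Pj : P j) : pi j = rowspan (A j *m Pa + B j *m Pb + Pc) by case: (hAB j Pj).
have Pd : P d by [].
have e0 : delta_mx 0 0 != 0 :> 'rV[F]_n.
  by apply/eqP => /matrixP/(_ 0 0); rewrite !mxE eqxx => /eqP; rewrite oner_eq0.
pose S1 := pencil_set pi a b Pb Pc; pose S2 := pencil_set pi b a Pa Pc.
(* Modulo [pi c], the rows [A Pa + B Pb] normalize to [A^-1 B Pb + Pa]: here [b] is at infinity and
   [a] plays the part of 0. *)
pose S3 := pencil_set pi c b Pb Pa.
have r1 : regular_spread_set S1.
  exact (pencil_set_regular k_gt2 arc ab ac bc da db dc pia pib pic pid k_card (@reg a)).
have r2 : regular_spread_set S2.
  have pid' : pi d = rowspan (Pb + Pa + Pc) by rewrite pid [Pa + Pb]addrC.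
  exact (pencil_set_regular k_gt2 arc ba bc ac db da dc pib pia pic pid' k_card (@reg b)).
have r3 : regular_spread_set S3.
  have pid' : pi d = rowspan (Pc + Pb + Pa) by rewrite pid; congr rowspan; rewrite addrC addrA addrAC.
  exact (pencil_set_regular k_gt2 arc cb ca ba dc db da pic pib pia pid' k_card (@reg c)).
have inl i j x : x \in pi j -> x \in (pi j + pi i)%VS by apply/subvP/addvSl.
have inr i j x : x \in pi i -> x \in (pi j + pi i)%VS by apply/subvP/addvSr.
have [dPa dPb] : \dim (rowspan Pa) = n /\ \dim (rowspan Pb) = n.
  by rewrite -pia -pib !(arc_dim arc).
have jin j (Pj : P j) (y : 'rV_n) : y *m A j *m Pa + y *m B j *m Pb + y *m Pc \in pi j.
  by rewrite (jE j Pj) -!mulmxA -!mulmxDr mem_rowspan.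
have hB j (Pj : P j) (y : 'rV_n) : y *m B j *m Pb + y *m Pc \in (pi j + pi a)%VS.
  have -> : y *m B j *m Pb + y *m Pc = (y *m A j *m Pa + y *m B j *m Pb + y *m Pc) - y *m A j *m Pa.
    by rewrite -[X in X - _]addrA [X in X - _]addrC addrK.
  by apply: memvB; [apply/inl/jin | apply: inr; rewrite pia mem_rowspan].
have hA j (Pj : P j) (y : 'rV_n) : y *m A j *m Pa + y *m Pc \in (pi j + pi b)%VS.
  have -> : y *m A j *m Pa + y *m Pc = (y *m A j *m Pa + y *m B j *m Pb + y *m Pc) - y *m B j *m Pb.
    by rewrite [X in X - _]addrAC addrK.
  by apply: memvB; [apply/inl/jin | apply: inr; rewrite pib mem_rowspan].
have B_S1 j : P j -> B j \in S1.
  by move=> Pj; apply/pencil_setP; exists j; case: (Pj) => ja jb _; split=> //; apply: hB.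
have A_S2 j : P j -> A j \in S2.
  by move=> Pj; apply/pencil_setP; exists j; case: (Pj) => ja jb _; split=> //; apply: hA.
have AB_S3 j : P j -> (A j)^-1 * B j \in S3.
  move=> Pj; apply/pencil_setP; exists j; case: (Pj) => ja jb jc; split=> // y.
  have := jin j Pj (y *m (A j)^-1); rewrite [_ *m A j]mulmxKV ?Au // mulmxA => h.
  have -> : y *m (A j)^-1 *m B j *m Pb + y *m Pa
      = y *m Pa + y *m (A j)^-1 *m B j *m Pb + y *m (A j)^-1 *m Pc - y *m (A j)^-1 *m Pc.
    by rewrite addrK addrC.
  by apply: memvB; [apply/inl | apply: inr; rewrite pic mem_rowspan].
have neq0 j : P j -> A j != 0 /\ B j != 0.
  by move=> Pj; split; apply: contraTneq (Au j Pj) => E; [| move: (Bu j Pj)]; rewrite E unitr0.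
have h0 i (y : 'rV_n) (Q : mx) : y *m (0 : 'M_n) *m Q + y *m Pc \in (pi c + pi i)%VS.
  by rewrite mulmx0 mul0mx add0r; apply: inl; rewrite pic mem_rowspan.
have uniqB := pencil_unique k_gt2 arc ab ac bc pia pib pic 0.
have uniqA := pencil_unique k_gt2 arc ba bc ac pib pia pic 0.
have idl (u v v' w : 'rV[F]_(3 * n)) : u + v + w - (u + v' + w) = v - v'.
  by rewrite opprD addrACA subrr addr0 opprD addrACA subrr add0r.
have idr (u u' v w : 'rV[F]_(3 * n)) : u + v + w - (u' + v + w) = u - u'.
  by rewrite opprD addrACA subrr addr0 opprD addrACA subrr addr0.
(* If the [A] coincide, vectors of [pi j] and [pi l] over the same [e] differ by an element of
   [pi b], against independence; likewise for the [B] and [pi a]. *)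
have inj j l : P j -> P l -> j != l -> A j != A l /\ B j != B l.
  move=> Pj Pl jl; have [ja jb _] := Pj; have [la lb _] := Pl.
  pose e : 'rV[F]_n := delta_mx 0 0.
  have nz : e *m A j *m Pa + e *m B j *m Pb + e *m Pc = 0 -> e == 0.
    by move=> /(indep _ _ _)[_ _ ->].
  have jinN (l' : 'I_k) (Pl' : P l') y : - (y *m A l' *m Pa + y *m B l' *m Pb + y *m Pc) \in pi l'.
    by rewrite memvN jin.
  split; apply: contraNneq e0 => E; apply: nz.
    have mb : e *m (B l - B j) *m Pb \in pi b by rewrite pib mem_rowspan.
    have [|-> //] := arc_indep k_gt2 arc jl jb lb (jin j Pj e) (jinN l Pl e) mb.
    by rewrite E mulmxBr mulmxBl idl addrA subrK subrr.
  have ma : e *m (A l - A j) *m Pa \in pi a by rewrite pia mem_rowspan.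
  have [|-> //] := arc_indep k_gt2 arc jl ja la (jin j Pj e) (jinN l Pl e) ma.
  by rewrite E mulmxBr mulmxBl idr addrA subrK subrr.
have coord (X Y u v w z : 'rV_n) :
    X *m Pa + Y *m Pb = u *m Pa + v *m Pb + w *m Pc + z *m (Pa + Pb + Pc) ->
  [/\ X = u + z, Y = v + z & w + z = 0].
  rewrite !mulmxDr addrACA -mulmxDl addrACA -!mulmxDl => /eqP; rewrite -subr_eq0 opprD addrA.
  rewrite opprD addrACA -!mulmxBl -mulNmx => /eqP/(indep _ _ _)[/eqP + /eqP + /eqP].
  by rewrite !subr_eq0 oppr_eq0 => /eqP-> /eqP-> /eqP.
have S12 : S1 = S2.
  apply: (@spread_sets_coincide _ _ _ P A B S1 S2 S3) => //.
  - by move=> j Pj; have [A0 B0] := neq0 j Pj; rewrite A_S2 // B_S1 // AB_S3.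
  - move=> M /pencil_setP[j [ja jb h]] M0.
    have jc : j != c.
      apply: contraNneq M0 => jc; apply/eqP.
      by apply: (uniqB j c M 0 ja jb ca cb h _).1 => // y; apply: h0.
    have Pj : P j by [].
    by exists j => //; apply: (uniqB j j _ _ ja jb ja jb (hB j Pj) h).1.
  - move=> M /pencil_setP[j [jb ja h]] M0.
    have jc : j != c.
      apply: contraNneq M0 => jc; apply/eqP.
      by apply: (uniqA j c M 0 jb ja cb ca h _).1 => // y; apply: h0.
    have Pj : P j by [].
    by exists j => //; apply: (uniqA j j _ _ jb ja jb ja (hA j Pj) h).1.
  have [Ad Bd] : A d = 1 /\ B d = 1.
    have hd (y : 'rV_n) : y *m Pa + y *m Pb + y *m Pc \in pi d.
      by rewrite pid -!mulmxDr mem_rowspan.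
    split; [apply: (uniqA d d _ _ db da db da (hA d Pd) _).1
           | apply: (uniqB d d _ _ da db da db (hB d Pd) _).1] => // y; rewrite mulmx1.
      rewrite -[_ + _](addrK (y *m Pb)) [y *m Pa + _ + _]addrAC.
      by apply: memvB; [apply/inl/hd | apply: inr; rewrite pib mem_rowspan].
    rewrite -[_ + _](addrK (y *m Pa)) [_ + y *m Pa]addrC addrA.
    by apply: memvB; [apply/inl/hd | apply: inr; rewrite pia mem_rowspan].
  move=> t j t0 Pj A1 B1; have [ja jb jc] := Pj.
  have jd : j != d by apply: contraNneq A1 => ->; rewrite Ad.
  have [ad [bd dj]] : a != d /\ b != d /\ d != j by rewrite [a == d]eq_sym [b == d]eq_sym [d == j]eq_sym.
  have [aj bj] : a != j /\ b != j by rewrite [a == j]eq_sym [b == j]eq_sym.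
  (* The fourth viewpoint: over each [x], the vector of [pi j] minus that of [pi d] has components
     only in [pi a] and [pi b], so it is a transversal modulo [pi d]. The cases [r = a] and [r = b]
     contradict [B j != 1] and [A j != 1], [r = c] gives the first alternative, and any other [r]
     serves as [m]. *)
  have [r rd hr] := @reg d a b j t ad bd jd ab aj bj.
  have {}hr (x : 'rV_n) : x *m (A j - 1) *m Pa + (t *: (x *m (B j - 1))) *m Pb \in (pi r + pi d)%VS.
    rewrite -scalemxAl; apply: hr; try by apply: inl; rewrite ?pia ?pib mem_rowspan.
    have -> : x *m (A j - 1) *m Pa + x *m (B j - 1) *m Pb =
        (x *m A j *m Pa + x *m B j *m Pb + x *m Pc) - x *m (Pa + Pb + Pc).
      rewrite !mulmxBr !mulmxBl !mulmx1 !mulmxDr opprD [RHS]addrACA subrr addr0.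
      by rewrite opprD addrACA.
    by apply: memvB; [apply/inl/jin | apply: inr; rewrite pid mem_rowspan].
  have [ra | ra] := eqVneq r a.
    case/eqP: B1; apply/eqP; rewrite -subr_eq0; apply/eqP/eq_row_mul => x; rewrite mulmx0.
    have := hr x; rewrite ra pia pid => /memv_addP[_ /rowspanP[u ->] [_ /rowspanP[z ->] E]].
    have [|_ Y0 w0] := @coord (x *m (A j - 1)) (t *: (x *m (B j - 1))) u 0 0 z.
      by rewrite E !mul0mx !addr0.
    move: w0 Y0; rewrite add0r => -> /eqP; rewrite scaler_eq0 (negPf t0) /=.
    by move/eqP.
  have [rb | rb] := eqVneq r b.
    case/eqP: A1; apply/eqP; rewrite -subr_eq0; apply/eqP/eq_row_mul => x; rewrite mulmx0.
    have := hr x; rewrite rb pib pid => /memv_addP[_ /rowspanP[u ->] [_ /rowspanP[z ->] E]].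
    have [|X0 _ w0] := @coord (x *m (A j - 1)) (t *: (x *m (B j - 1))) 0 u 0 z.
      by rewrite E !mul0mx addr0 add0r.
    by rewrite X0 w0.
  have [rc | rc] := eqVneq r c.
    left; apply: eq_row_mul => x.
    have := hr x; rewrite rc pic pid => /memv_addP[_ /rowspanP[u ->] [_ /rowspanP[z ->] E]].
    have [|X0 Y0 _] := @coord (x *m (A j - 1)) (t *: (x *m (B j - 1))) 0 0 u z.
      by rewrite E !mul0mx !add0r.
    by rewrite -scalemxAr Y0 X0.
  have Pr : P r by [].
  right; have [Ar1 Br1] := inj r d Pr Pd rd; rewrite Ad in Ar1; rewrite Bd in Br1.
  have Aru : A r - 1 \in unitmx.
    by have [_ du _ _ _] := r2; rewrite -Ad; apply: du; rewrite ?A_S2 // Ad.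
  exists ((A j - 1) * (A r - 1)^-1), r => //; split=> //; first by rewrite mulrVK.
  apply: eq_row_mul => x.
  have := hr x; rewrite (jE r Pr) pid => /memv_addP[_ /rowspanP[u ->] [_ /rowspanP[z ->] E]].
  have [|X0 Y0 w0] := @coord (x *m (A j - 1)) (t *: (x *m (B j - 1))) (u *m A r) (u *m B r) u z.
    by rewrite E !mulmxDr !mulmxA.
  have zE : z = - u by apply/eqP; rewrite -addr_eq0 addrC w0.
  have uE : u = x *m ((A j - 1) * (A r - 1)^-1).
    rewrite mulmxA X0 zE -[X in _ - X]mulmx1 -mulmxBr.
    by rewrite mulmxK.
  by rewrite -scalemxAr Y0 zE mulmxA -uE mulmxBr mulmx1.
have [M MS Msc] := spread_set_nonscalar q_gt2 n_pr r1.
have S1E := regular_spread_set_field q_gt2 n_pr r1 MS Msc.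
exists Pa, Pb, Pc, M; split.
- exact: mxminpoly_spread_set_irreducible r1 _ MS.
- exact: degree_mxminpoly_spread_set r1 _ MS Msc.
have [m0 m1] : 0 \in mx_poly_span M /\ 1 \in mx_poly_span M.
  by rewrite mem0v -S1E; case: r1 => -[].
move=> j; have [-> | ja] := eqVneq j a.
  by exists 1, 0, 0; rewrite !mul0mx !addr0 mul1mx.
have [-> | jb] := eqVneq j b.
  by exists 0, 1, 0; rewrite !mul0mx addr0 add0r mul1mx.
have [-> | jc] := eqVneq j c.
  by exists 0, 0, 1; rewrite !mul0mx !add0r mul1mx.
have Pj : P j by [].
by exists (A j), (B j), 1; rewrite -!S1E B_S1 // S12 A_S2 // mul1mx -jE // -S12 S1E.
Qed.

End CommonField.

(** * Galois descent *)

Section MapVspace.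

Variables (K L : fieldType) (m : nat) (f : {rmorphism K -> L}).

Lemma mem_map_vspace (U : {vspace 'rV[K]_m}) v :
  v \in U -> map_mx f v \in map_vspace f U.
Proof.
move=> vU; rewrite (coord_vbasis vU) raddf_sum memv_suml // => i _.
by rewrite /= map_mxZ memvZ // memv_span // map_f // mem_nth ?size_tuple.
Qed.

Lemma map_vspace_subv (U : {vspace 'rV[K]_m}) (X : {vspace 'rV[L]_m}) :
  (forall v, v \in U -> map_mx f v \in X) -> (map_vspace f U <= X)%VS.
Proof.
by move=> h; apply/span_subvP => _ /mapP[v /vbasis_mem vU ->]; apply: h.
Qed.

Lemma dim_map_vspace (U : {vspace 'rV[K]_m}) : (\dim (map_vspace f U) <= \dim U)%N.
Proof. by apply: leq_trans (dim_span _) _; rewrite size_map size_tuple. Qed.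

Lemma map_vspace_full : map_vspace f {:'rV[K]_m} = fullv.
Proof.
apply/eqP; rewrite eqEsubv subvf; apply/subvP => u _.
rewrite (row_sum_delta u) memv_suml // => i _.
by rewrite memvZ // -(map_delta_mx f) mem_map_vspace ?memvf.
Qed.

End MapVspace.

Section Trace.

Variables (F : finFieldType) (L : splittingFieldType F).
Local Notation G := ('Gal({:L} / 1)%g).

Lemma card_gal : #|G| = \dim {:L}.
Proof.
by rewrite -galois_dim ?finField_galois ?sub1v //= dimv1 divn1.
Qed.

(** [galTrace] takes its values in the line [F 1] of [L]; the coordinate on the basis [1] brings
    them back to [F]. *)
Definition trF (a : L) : F := coord [tuple 1] ord0 (galTrace 1 {:L} a).

Lemma trFE a : (trF a)%:A = \sum_(s in G) s a.
Proof.
have : galTrace 1 {:L} a \in 1%VS.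
  have {2}<- : fixedField G = 1%AS by apply/galois_fixedField/finField_galois/sub1v.
  by rewrite galTrace_fixedField ?memvf.
case/vlineP=> t tE; rewrite /trF -/(galTrace 1 {:L} a) tE linearZ /=.
by rewrite (coord_free ord0 ord0 (X := [tuple 1])) ?seq1_free ?oner_eq0 // eqxx mulr1.
Qed.

Definition Tr m (u : 'rV[L]_m) : 'rV[F]_m := map_mx trF u.

Lemma TrE m (u : 'rV[L]_m) : map_mx (in_alg L) (Tr u) = \sum_(s in G) map_mx s u.
Proof.
apply/rowP => i; rewrite summxE !mxE /= trFE.
by apply: eq_bigr => s _; rewrite mxE.
Qed.

Lemma gal_in_alg m p (s : gal_of {:L}) (P : 'M[F]_(m, p)) :
  map_mx s (map_mx (in_alg L) P) = map_mx (in_alg L) P.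
Proof. by apply/matrixP => i j; rewrite !mxE /= rmorph_alg. Qed.

Lemma TrD m (u v : 'rV[L]_m) : Tr (u + v) = Tr u + Tr v.
Proof.
apply: (@map_mx_inj _ _ (in_alg L)); rewrite map_mxD !TrE -big_split /=.
by apply: eq_bigr => s _; rewrite map_mxD.
Qed.

Lemma TrM m p (u : 'rV[L]_m) (P : 'M[F]_(m, p)) :
  Tr (u *m map_mx (in_alg L) P) = Tr u *m P.
Proof.
apply: (@map_mx_inj _ _ (in_alg L)); rewrite map_mxM !TrE mulmx_suml.
by apply: eq_bigr => s _; rewrite map_mxM gal_in_alg.
Qed.

Lemma TrZ m t (u : 'rV[L]_m) : Tr (t%:A *: u) = t *: Tr u.
Proof.
by rewrite -mul_mx_scalar -[t%:A]/(in_alg L t) -map_scalar_mx TrM mul_mx_scalar.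
Qed.

Lemma Tr0 m : Tr (0 : 'rV[L]_m) = 0.
Proof. by rewrite -[0 in LHS](scale0r 0) -(scale0r (1 : L)) TrZ scale0r. Qed.

Lemma Tr_sum m (I : Type) (r : seq I) (f : I -> 'rV[L]_m) :
  Tr (\sum_(i <- r) f i) = \sum_(i <- r) Tr (f i).
Proof. by apply: (big_morph (@Tr m) (@TrD m) (@Tr0 m)). Qed.

(** Independence of the automorphisms gives an element of nonzero trace, which is then rescaled. *)
Lemma exists_trF1 : exists c, trF c = 1.
Proof.
have [|a _ ta] := @gal_independent_contra _ L _ (mem G) (fun=> 1) 1%g (fingroup.group1 _).
  exact: oner_neq0.
have t0 : trF a != 0.
  apply: contraNneq ta => t0; have := trFE a; rewrite t0 scale0r => E.
  by rewrite (eq_bigr (fun s : gal_of {:L} => s a)) -?E // => s _; rewrite mul1r.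
exists ((trF a)^-1%:A * a).
have := TrZ (trF a)^-1 (\row_(i < 1) a) => /rowP/(_ 0); rewrite !mxE => ->.
by rewrite mulVf.
Qed.

(* Invertibility of the matrix of conjugates of a basis of [L] recovers each
   conjugate of [u] from the traces of the multiples of [u]. *)
Lemma gal_conj_Tr (s : gal_of {:L}) : s \in G -> exists N (w z : 'I_N -> L),
  forall m (u : 'rV[L]_m),
    map_mx s u = \sum_i z i *: map_mx (in_alg L) (Tr (w i *: u)).
Proof.
move=> sG; have [w _ [Mu _ _]] := gal_matrix G; set M := (X in X \in unitmx) in Mu.
pose i0 := enum_rank_in sG s.
exists #|G|, (tnth w), (fun j => invmx M j i0) => m u.
under eq_bigr do rewrite TrE big_enum_val /= scaler_sumr.
rewrite exchange_big /= (bigD1 i0) //= [X in _ + X]big1 ?addr0 => [|i ii0].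
  under eq_bigr do rewrite map_mxZ scalerA mulrC.
  rewrite -scaler_suml enum_rankK_in //.
  have := mulmxV Mu => /matrixP/(_ i0 i0); rewrite !mxE eqxx => E.
  rewrite (eq_bigr (fun j => M i0 j * invmx M j i0)) ?E ?scale1r // => j _.
  by rewrite mxE enum_rankK_in.
under eq_bigr do rewrite map_mxZ scalerA mulrC.
rewrite -scaler_suml; have := mulmxV Mu => /matrixP/(_ i i0); rewrite !mxE (negPf ii0) => E.
rewrite (eq_bigr (fun j => M i j * invmx M j i0)) ?E ?scale0r // => j _.
by rewrite mxE.
Qed.

Section Descent.

Variable m : nat.
Implicit Types (P : {vspace 'rV[F]_m}) (U : {vspace 'rV[L]_m}).

(** For [c] of trace 1, [w] is the trace of [c w], and the trace of an [L]-combination of vectors of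
    [P] is an [F]-combination of them. *)
Lemma mem_in_alg P w : map_mx (in_alg L) w \in map_vspace (in_alg L) P -> w \in P.
Proof.
have [c c1] := exists_trF1.
have TrC t (x : 'rV[F]_m) : Tr (t *: map_mx (in_alg L) x) = trF t *: x.
  apply/rowP => i; rewrite !mxE /=.
  have := TrZ (x 0 i) (\row_(i < 1) t) => /rowP/(_ 0); rewrite !mxE mulrC => ->.
  by rewrite mulrC.
move=> h; have := TrC c w; rewrite c1 scale1r => <-.
pose X := map_tuple (map_mx (in_alg L)) (vbasis P).
have /coord_span -> : map_mx (in_alg L) w \in <<X>>%VS by [].
rewrite scaler_sumr Tr_sum memv_suml // => i _.
have -> : X`_i = map_mx (in_alg L) (vbasis P)`_i by rewrite (nth_map 0) ?size_tuple.
by rewrite scalerA TrC memvZ // vbasis_mem // mem_nth ?size_tuple.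
Qed.

Lemma Tr_mem_of_sum P U u :
    map_vspace (in_alg L) P = (\sum_(s in G) map_vspace s U)%VS ->
  u \in U -> Tr u \in P.
Proof.
move=> E uU; apply: mem_in_alg; rewrite E TrE memv_sumr // => s _.
exact: mem_map_vspace.
Qed.

(** [U] is closed under [L]-multiples, so [P] contains the trace of every multiple of [u]; these
    traces recover all conjugates of [u]. *)
Lemma gal_sum_sub P U : (forall u, u \in U -> Tr u \in P) ->
  (\sum_(s in G) map_vspace s U <= map_vspace (in_alg L) P)%VS.
Proof.
move=> h; apply/subv_sumP => s sG; apply: map_vspace_subv => u uU.
have [N [w [z ->]]] := gal_conj_Tr sG; rewrite memv_suml // => i _.
by rewrite memvZ // mem_map_vspace // h // memvZ.
Qed.

Lemma sub_gal_sum P U : (forall w, w \in P -> exists2 u, u \in U & w = Tr u) ->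
  (map_vspace (in_alg L) P <= \sum_(s in G) map_vspace s U)%VS.
Proof.
move=> h; apply: map_vspace_subv => _ /h[u uU ->].
by rewrite TrE memv_sumr // => s _; apply: mem_map_vspace.
Qed.

(** The conjugates of [U] span the whole space, and there are as many of them as the degree of [L].
    This bound is what excludes collinear triples. *)
Lemma dim_Tr_surj U : (forall w, exists2 u, u \in U & w = Tr u) ->
  (m <= \dim {:L} * \dim U)%N.
Proof.
move=> h; have := sub_gal_sum (P := fullv) (fun w _ => h w).
rewrite map_vspace_full => /dimvS; rewrite dim_rV => /leq_trans; apply.
apply: leq_trans (dimv_leq_sum _ _ _) _.
rewrite -card_gal -sum_nat_const leq_sum // => s _; exact: dim_map_vspace.
Qed.

End Descent.
End Trace.

Lemma eigen_horner_mx (F : fieldType) n' (A : 'M[F]_n'.+1) (v : 'rV_n'.+1) z p :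
  v *m A = z *: v -> v *m horner_mx A p = p.[z] *: v.
Proof.
move=> vA; elim/poly_ind: p => [|p c IH]; first by rewrite rmorph0 mulmx0 horner0 scale0r.
rewrite rmorphD rmorphM /= horner_mx_X horner_mx_C mulmxDr [_ * A]/(_ *m _) mulmxA IH.
by rewrite -scalemxAl vA mul_mx_scalar scalerA -scalerDl hornerMXaddC.
Qed.

Lemma Fadjoin1_horner (F : fieldType) (L : fieldExtType F) (z : L) :
  <<1; z>>%VS = fullv -> forall a, exists p, a = (map_poly (in_alg L) p).[z].
Proof.
move=> full a; have aK : a \in <<1; z>>%VS by rewrite full memvf.
have /polyOver1P[p pE] := Fadjoin_polyOver 1 z a.
by exists p; rewrite -pE Fadjoin_poly_eq.
Qed.

Lemma irredp_splitting_field (F : finFieldType) (p : {poly F}) : irreducible_poly p ->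
  exists (L : splittingFieldType F) (z : L),
    [/\ \dim {:L} = (size p).-1, root (map_poly (in_alg L) p) z
      & forall a, exists r, a = (map_poly (in_alg L) r).[z]].
Proof.
case/irredp_FAdjoin=> L dimL [z rz full]; exists (FinSplittingFieldType F L), z.
by split=> //; apply: Fadjoin1_horner.
Qed.

(** * From a common field to a plane and its hyperoval *)

Section FieldReduction.

Variables (F : finFieldType) (n' : nat).
Local Notation n := n'.+1.
Local Notation k := (#|F| ^ n + 2)%N.
Variable pi : 'I_k -> {vspace 'rV[F]_(3 * n)}.
Hypothesis arc : generalized_arc pi.

Theorem field_reduced_of_common_field (Pa Pb Pc : 'M[F]_(n, 3 * n)) (M : 'M[F]_n) :
    irreducible_poly (mxminpoly M) -> degree_mxminpoly M = n ->
    (forall j, exists A B C : 'M_n,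
        [/\ A \in mx_poly_span M, B \in mx_poly_span M, C \in mx_poly_span M
          & pi j = rowspan (A *m Pa + B *m Pb + C *m Pc)]) ->
  field_reduced_hyperoval pi.
Proof.
move=> irr degM hP.
have k_gt2 : (2 < k)%N by rewrite addn2 !ltnS expn_gt0; apply/orP; left; apply/card_gt0P; exists 0.
have [L [z [dimL rz gen]]] := irredp_splitting_field irr.
rewrite size_mxminpoly /= degM in dimL.
pose up m p (X : 'M[F]_(m, p)) := map_mx (in_alg L) X.
have [v vM v0] : exists2 v : 'rV[L]_n, v *m up _ _ M = z *: v & v != 0.
  by apply/eigenvalueP; rewrite eigenvalue_root_min mxminpoly_map.
have vpoly X : X \in mx_poly_span M -> exists a : L, v *m up _ _ X = a *: v.
  case/mx_poly_spanP=> p ->; exists (map_poly (in_alg L) p).[z].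
  by rewrite /up map_horner_mx (eigen_horner_mx _ vM).
have Trv0 : (forall a, Tr (a *: v) = 0) -> v = 0.
  move=> h; have [N [w [z' E]]] := gal_conj_Tr (fingroup.group1 'Gal({:L} / 1)).
  have : map_mx (1%g : gal_of {:L}) v = 0.
    by rewrite E big1 // => i _; rewrite h map_mx0 scaler0.
  by move=> /matrixP h'; apply/matrixP => i j; have := h' i j; rewrite !mxE gal_id.
(* The map sending [a] to [Tr (a *: v)] goes between spaces of dimension [n]. If it killed some
   nonzero [a], it would kill every [b], because [b *: v] is the image of [a *: v] under a
   polynomial in [M]; then [v] would be 0. *)
have surj (x : 'rV[F]_n) : exists a : L, x = Tr (a *: v).
  have lin : linear (fun a : L => Tr (a *: v)).
    by move=> t a b; rewrite scalerDl TrD -TrZ scalerA mulr_algl.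
  pose f0 := GRing.isLinear.Build _ _ _ _ _ lin.
  pose f : {linear L -> 'rV[F]_n} := HB.pack (fun a : L => Tr (a *: v)) f0.
  have kf : lker (linfun f) == 0%VS.
    rewrite -subv0; apply/subvP => a; rewrite memv_ker memv0 lfunE /= => /eqP fa0.
    apply: contraNT v0 => a0; apply/eqP/Trv0 => b.
    have [p pE] := gen (b / a).
    have -> : b *: v = a *: v *m up _ _ (horner_mx M p).
      by rewrite -scalemxAl /up map_horner_mx (eigen_horner_mx _ vM) -pE scalerA mulrC divfK.
    by rewrite TrM fa0 mul0mx.
  have : x \in limg (linfun f).
    suffices -> : limg (linfun f) = fullv by rewrite memvf.
    have df : \dim (limg (linfun f)) = n by rewrite limg_dim_eq ?dimL // (eqP kf) capv0.
    by apply/eqP; rewrite eqEdim subvf dim_rV df leqnn.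
  by case/memv_imgP=> a _ ->; exists a; rewrite lfunE.
have ex j : exists Q : 'M[F]_(n, 3 * n), pi j = rowspan Q /\
    v *m up _ _ Q \in (<[v *m up _ _ Pa]> + <[v *m up _ _ Pb]> + <[v *m up _ _ Pc]>)%VS.
  have [A [B [C [/vpoly[a aE] /vpoly[b bE] /vpoly[c cE] jE]]]] := hP j.
  exists (A *m Pa + B *m Pb + C *m Pc); split=> //.
  rewrite /up !map_mxD !map_mxM !mulmxDr !mulmxA -/(up _ _ _) aE bE cE.
  by rewrite -!scalemxAl !memv_add // memvZ // memv_line.
have [Q hQ] := fin_all_exists ex.
pose x j := <[v *m up _ _ (Q j)]>%VS.
pose xi := (<[v *m up _ _ Pa]> + <[v *m up _ _ Pb]> + <[v *m up _ _ Pc]>)%VS.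
have Tr_x j u : u \in x j -> Tr u \in pi j.
  case/vlineP=> a ->; rewrite (hQ j).1 scalemxAl TrM; exact: mem_rowspan.
have x_Tr j w : w \in pi j -> exists2 u, u \in x j & w = Tr u.
  rewrite (hQ j).1 => /rowspanP[y ->]; have [a ->] := surj y.
  by exists (a *: (v *m up _ _ (Q j))); rewrite ?memvZ ?memv_line // scalemxAl TrM.
(* The trace maps a space containing three of the points onto [pi i + pi j + pi l], which is
   everything, so the space has dimension at least 3. *)
have dim3 i j l (t : {vspace 'rV[L]_(3 * n)}) : i != j -> i != l -> j != l ->
    (x i <= t)%VS -> (x j <= t)%VS -> (x l <= t)%VS -> (3 <= \dim t)%N.
  move=> ij il jl it jt lt; have : (3 * n <= \dim {:L} * \dim t)%N.
    apply: dim_Tr_surj => w.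
    have : w \in (pi i + pi j + pi l)%VS by case: arc => _ _ -> //; rewrite memvf.
    case/memv_addP=> _ /memv_addP[_ /x_Tr[u1 u1x ->] [_ /x_Tr[u2 u2x ->] ->]].
    case=> _ /x_Tr[u3 u3x ->] ->; exists (u1 + u2 + u3); last by rewrite !TrD.
    by apply: memvD; [apply: memvD; [apply: (subvP it) | apply: (subvP jt)] | apply: (subvP lt)].
  by rewrite dimL [X in (_ <= X)%N]mulnC leq_pmul2r.
have x_xi j : (x j <= xi)%VS by rewrite -memvE (hQ j).2.
have [i0 [i1 [i2 [i01 i02 i12]]]] : exists i0 i1 i2 : 'I_k, [/\ i0 != i1, i0 != i2 & i1 != i2].
  by exists (Ordinal (ltnW (ltnW k_gt2))), (Ordinal (ltnW k_gt2)), (Ordinal k_gt2).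
have dim_x j : \dim (x j) = 1%N.
  rewrite dim_vline; case: eqVneq => // E.
  have /eqP : \dim (pi j) = 0%N.
    apply/eqP; rewrite dimv_eq0 -subv0; apply/subvP => w /x_Tr[u].
    by rewrite /x E => /vlineP[a ->] ->; rewrite scaler0 Tr0 mem0v.
  by rewrite (arc_dim arc).
exists L, xi, x; split=> //.
- apply/eqP; rewrite eqn_leq (dim3 i0 i1 i2) // andbT.
  apply: leq_trans (dimv_add_leqif _ _) _; rewrite -[3%N]/(2 + 1)%N leq_add //; last first.
    by rewrite dim_vline leq_b1.
  by apply: leq_trans (dimv_add_leqif _ _) _; rewrite !dim_vline -[2%N]/(1 + 1)%N leq_add ?leq_b1.
- apply/eqP; rewrite eqEsubv subvf -(map_vspace_full _ (in_alg L)) /=.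
  apply: sub_gal_sum => w _.
  have : w \in (pi i0 + pi i1 + pi i2)%VS by case: arc => _ _ -> //; rewrite memvf.
  case/memv_addP=> _ /memv_addP[_ /x_Tr[u1 u1x ->] [_ /x_Tr[u2 u2x ->] ->]].
  case=> _ /x_Tr[u3 u3x ->] ->; exists (u1 + u2 + u3); last by rewrite !TrD.
  by do 2?apply: memvD; [apply: (subvP (x_xi i0)) | apply: (subvP (x_xi i1)) | apply: (subvP (x_xi i2))].
- split=> [i j xij | i | i j l ij il jl [t dt [it jt lt]]].
  + apply/eqP; apply: contraT => ij; have [l [il jl]] := third_index k_gt2 i j.
    have := dim3 i j l (x i + x l)%VS ij il jl; rewrite -xij addvSl addvSr => /(_ isT isT isT).
    rewrite leqNgt => /negP[]; rewrite ltnS.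
    by apply: leq_trans (dimv_add_leqif _ _) _; rewrite !dim_x.
  + by rewrite dim_x x_xi.
  by have := dim3 i j l t ij il jl it jt lt; rewrite dt.
move=> j; apply/eqP; rewrite eqEsubv; apply/andP; split; first exact/sub_gal_sum/x_Tr.
exact/gal_sum_sub/Tr_x.
Qed.

End FieldReduction.

(** * Projected spreads *)

Section ProjectedSpread.

Variables (F : finFieldType) (n : nat).
Local Notation k := (#|F| ^ n + 2)%N.
Variables (pi : 'I_k -> {vspace 'rV[F]_(3 * n)}) (W : {vspace 'rV[F]_(3 * n)}) (i : 'I_k).
Hypotheses (arc : generalized_arc pi) (dW : \dim W = (2 * n)%N) (W0 : (W :&: pi i = 0)%VS).
Let S j := ((pi i + pi j) :&: W)%VS.

Let k_gt2 : (2 < k)%N.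
Proof. by rewrite addn2 !ltnS expn_gt0; apply/orP; left; apply/card_gt0P; exists 0. Qed.

Lemma dim_projected j : j != i -> \dim (S j) = n.
Proof.
move=> ji; have ij : i != j by rewrite eq_sym.
have := dimv_sum_cap (pi i + pi j) W; rewrite (arc_dim2 k_gt2 arc ij) dW.
have -> : ((pi i + pi j) + W)%VS = fullv.
  apply/eqP; rewrite eqEsubv subvf; apply/subvP => v _.
  have [w wW vw] := arc_complement k_gt2 arc dW W0 v.
  by rewrite -[v](subrK w) memv_add // (subvP (addvSl _ _)).
rewrite dim_rV /S; lia.
Qed.

Lemma projected_cap j l : j != i -> l != i -> j != l -> (S j :&: S l = 0)%VS.
Proof.
move=> ji li jl; have [ij il] : i != j /\ i != l by rewrite ![i == _]eq_sym.
apply/eqP; rewrite -subv0; apply/subvP => w.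
rewrite !memv_cap => /andP[/andP[wj wW] /andP[wl _]].
by rewrite -W0 memv_cap wW -(arc_cap_pencil k_gt2 arc ij il jl) memv_cap wj.
Qed.

Lemma projected_spreadP U :
  reflect (exists2 j, j != i & U = S j) (U \in projected_spread pi i W).
Proof.
apply: (iffP imageP) => [[j] | [j ji ->]]; first by rewrite inE => ji ->; exists j.
by exists j.
Qed.

(* Counting: the [q^n + 1] projections have [q^n - 1] nonzero vectors each. *)
Lemma projected_cover w : w \in W -> w != 0 -> exists2 j, j != i & w \in S j.
Proof.
move=> wW w0; pose T j := if j == i then set0 else [set x in S j] :\ 0.
pose C := \bigcup_j T j.
have sub : C \subset [set x in W] :\ 0.
  apply/subsetP => x /bigcupP[j _]; rewrite /T; case: eqP => _; rewrite ?inE //.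
  by case/andP=> -> /memv_capP[].
have cardU (U : {vspace 'rV[F]_(3 * n)}) : #|[set x in U] :\ 0| = (#|F| ^ \dim U - 1)%N.
  by rewrite -card_vspace -[in RHS]cardsE [in RHS](cardsD1 0) inE mem0v addKn.
have cardC : #|C| = ((#|F| ^ n).+1 * (#|F| ^ n - 1))%N.
  rewrite -sum1_card partition_disjoint_bigcup /= => [|j l jl].
    rewrite (bigD1 i) //= {1}/T eqxx big_set0 add0n.
    rewrite (eq_bigr (fun=> (#|F| ^ n - 1)%N)) => [|j ji].
      have cE : #|predC1 i| = (#|F| ^ n).+1 by rewrite cardC1 card_ord; lia.
      by rewrite sum_nat_const -cE; congr (_ * _)%N; apply: eq_card => j; rewrite !inE.
    by rewrite sum1_card /T (negPf ji) cardU dim_projected.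
  rewrite /T; case: (eqVneq j i) => [|ji]; first by rewrite -setI_eq0 set0I.
  case: (eqVneq l i) => [|li]; first by rewrite -setI_eq0 setI0.
  rewrite -setI_eq0 -subset0; apply/subsetP => x; rewrite !inE.
  case/andP=> /andP[x0 xj] /andP[_ xl]; case/negP: x0.
  by rewrite -memv0 -(projected_cap ji li jl) memv_cap xj.
have CE : C = [set x in W] :\ 0.
  apply/eqP; rewrite eqEcard sub cardC cardU dW mulnC expnM.
  by move: (#|F| ^ n)%N => q; rewrite -[(q ^ 2)%N]/(q * q)%N; nia.
have : w \in C by rewrite CE !inE w0.
case/bigcupP=> j _; rewrite /T; case: eqVneq => [|ji]; rewrite !inE // => /andP[_ wj].
by exists j.
Qed.

Lemma projected_is_spread : is_spread n W (projected_spread pi i W).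
Proof.
split=> [_ /projected_spreadP[j ji ->] | A B | P dP PW].
- by rewrite capvSr dim_projected.
- move=> /projected_spreadP[j ji ->] /projected_spreadP[l li ->] AB.
  by apply: projected_cap => //; apply: contraNneq AB => ->.
have P0 : vpick P != 0 by rewrite vpick0 -dimv_eq0 dP.
have [j ji wj] := projected_cover (subvP PW _ (memv_pick P)) P0.
exists (S j); first by apply/projected_spreadP; exists j.
suffices -> : P = <[vpick P]>%VS by rewrite -memvE.
by apply/esym/eqP; rewrite eqEdim -memvE memv_pick dP dim_vline P0.
Qed.

End ProjectedSpread.

(** * Reguli as sublines of the projective line over [L] *)

Section FieldRegulus.

Variables (F : finFieldType) (V : vectType F) (L : fieldExtType F).
Variables (W : {vspace V}) (th1 th2 : 'Hom(V, L)).
Local Notation n := (\dim {:L}).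
Hypothesis dW : \dim W = (2 * n)%N.
Hypothesis th_inj : forall w, w \in W -> th1 w = 0 -> th2 w = 0 -> w = 0.

(* the vectors of [W] whose image in [L * L] is on the [L]-line through [st] *)
Definition line_preim (st : F * F) : {vspace V} :=
  (W :&: lker (st.2 *: th1 - st.1 *: th2))%VS.

Lemma mem_line_preim st w :
  (w \in line_preim st) = (w \in W) && (st.2 *: th1 w == st.1 *: th2 w).
Proof.
by rewrite memv_cap memv_ker add_lfunE opp_lfunE !scale_lfunE subr_eq0.
Qed.

(** The pair of forms is injective on [W], whose dimension equals that of [L * L]. *)
Lemma th_surj (a b : L) : exists2 w, w \in W & th1 w = a /\ th2 w = b.
Proof.
have lin : linear (fun w : V => (th1 w, th2 w) : L * L).
  by move=> t u v; rewrite !linearP.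
pose f0 := GRing.isLinear.Build _ _ _ _ _ lin.
pose f : {linear V -> (L * L)%type} := HB.pack (fun w : V => (th1 w, th2 w)) f0.
have : (a, b) \in (linfun f @: W)%VS.
  suffices -> : (linfun f @: W)%VS = fullv by rewrite memvf.
  apply/eqP; rewrite eqEdim subvf limg_dim_eq.
    by rewrite dW !dimvf -[dim (L * L)%type]/(dim L + dim L)%N mul2n addnn /=.
  apply/eqP; rewrite -subv0; apply/subvP => w /memv_capP[wW].
  by rewrite memv_ker lfunE memv0 => /eqP[h1 h2]; rewrite (th_inj wW).
by case/memv_imgP=> w wW; rewrite lfunE => -[-> ->]; exists w.
Qed.

Lemma dim_line_preim st : st != (0, 0) -> \dim (line_preim st) = n.
Proof.
move=> st0; have := limg_ker_dim (st.2 *: th1 - st.1 *: th2) W.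
have -> : ((st.2 *: th1 - st.1 *: th2) @: W)%VS = fullv.
  apply/eqP; rewrite eqEsubv subvf; apply/subvP => a _.
  have [s0 | s0] := eqVneq st.1 0.
    have t0 : st.2 != 0.
      by apply: contraNneq st0 => t0; case: st s0 t0 => s t /= -> ->.
    have [w wW [h1 h2]] := th_surj (st.2^-1 *: a) 0.
    apply/memv_imgP; exists w => //.
    by rewrite add_lfunE opp_lfunE !scale_lfunE h1 h2 scaler0 subr0 scalerA mulfV // scale1r.
  have [w wW [h1 h2]] := th_surj 0 (- (st.1^-1 *: a)).
  apply/memv_imgP; exists w => //.
  by rewrite add_lfunE opp_lfunE !scale_lfunE h1 h2 scaler0 scalerN opprK add0r scalerA mulfV // scale1r.
by rewrite dW -/(line_preim st) mul2n -addnn => /addIn.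
Qed.

(** The [q + 1] points of the projective line over [F], normalized, with [None] at infinity. *)
Definition pt (o : option F) : F * F := if o is Some t then (1, t) else (0, 1).

Definition field_regulus : seq {vspace V} := [seq line_preim (pt o) | o : option F].

Let det (x y : F * F) := x.1 * y.2 - y.1 * x.2.

Lemma pt_neq0 o : pt o != (0, 0).
Proof. by case: o => [t|]; rewrite xpair_eqE oner_eq0 ?andbF. Qed.

Lemma det_pt o o' : o != o' -> det (pt o) (pt o') != 0.
Proof.
case: o o' => [t|] [t'|] //= oo'; rewrite /det /= ?mul1r ?mul0r ?mulr1 ?subr0 ?sub0r ?oppr_eq0 ?oner_eq0 //.
by rewrite subr_eq0 eq_sym; apply: contraNneq oo' => ->.
Qed.

Lemma pt_repr s t : (s, t) != (0, 0) :> F * F ->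
  exists o z, [/\ z != 0, s = z * (pt o).1 & t = z * (pt o).2].
Proof.
have [-> | s0 _] := eqVneq s 0.
  rewrite xpair_eqE eqxx /= => t0; exists None, t; rewrite /= mulr0 mulr1.
  by split.
by exists (Some (t / s)), s; split=> //=; rewrite ?mulr1 // mulrCA mulfV ?mulr1.
Qed.

Lemma line_preimP st w : st != (0, 0) ->
  reflect (w \in W /\ exists om, th1 w = st.1 *: om /\ th2 w = st.2 *: om) (w \in line_preim st).
Proof.
move=> st0; rewrite mem_line_preim; apply: (iffP andP) => [[wW /eqP E] | [wW [om [-> ->]]]]; split=> //.
  have [s0 | s0] := eqVneq st.1 0.
    have t0 : st.2 != 0.
      by apply: contraNneq st0 => t0; case: st s0 t0 {E} => s t /= -> ->.
    exists (st.2^-1 *: th2 w); split; last by rewrite scalerA mulfV // scale1r.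
    by apply: (scalerI t0); rewrite E s0 !scale0r scaler0.
  exists (st.1^-1 *: th1 w); rewrite scalerA mulfV // scale1r; split=> //.
  by apply: (scalerI s0); rewrite -E !scalerA mulrAC mulfV // mul1r.
by rewrite !scalerA mulrC.
Qed.

Lemma line_preim_cap o o' : o != o' -> (line_preim (pt o) :&: line_preim (pt o') = 0)%VS.
Proof.
move=> oo'; apply/eqP; rewrite -subv0; apply/subvP => w /memv_capP[].
rewrite !mem_line_preim => /andP[wW /eqP E] /andP[_ /eqP E']; rewrite memv0.
move: E E' (det_pt oo'); rewrite /det; move: (pt o) (pt o') => [s t] [s' t'] /= E E' d0.
apply/eqP/th_inj => //; apply: (scalerI d0); rewrite scaler0 scalerBl.
  by rewrite -!scalerA E' E !scalerA [s' * s]mulrC subrr.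
by rewrite [s * t']mulrC [s' * t]mulrC -!scalerA -E -E' !scalerA [t' * t]mulrC subrr.
Qed.

Lemma field_regulusP U : reflect (exists o, U = line_preim (pt o)) (U \in field_regulus).
Proof. by apply: (iffP imageP) => [[o _ ->] | [o ->]]; exists o. Qed.

(* [l] is carried to the [F]-plane [om F^2] of [L * L]. *)
Lemma transversal_frame l o1 o2 o3 : (l <= W)%VS -> \dim l = 2%N ->
    o1 != o2 -> o1 != o3 -> o2 != o3 ->
    (l :&: line_preim (pt o1) != 0)%VS -> (l :&: line_preim (pt o2) != 0)%VS ->
    (l :&: line_preim (pt o3) != 0)%VS ->
  exists a b om, [/\ om != 0, l = (<[a]> + <[b]>)%VS,
    th1 a = (pt o1).1 *: om /\ th2 a = (pt o1).2 *: om
    & th1 b = (pt o2).1 *: om /\ th2 b = (pt o2).2 *: om].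
Proof.
move=> lW dl o12 o13 o23 m1 m2 m3.
have pick o : (l :&: line_preim (pt o) != 0)%VS -> exists2 w, w != 0 & w \in l /\ w \in line_preim (pt o).
  move=> nz; exists (vpick (l :&: line_preim (pt o))); first by rewrite vpick0.
  exact/memv_capP/memv_pick.
have [a a0 [al aU]] := pick _ m1; have [b b0 [bl bU]] := pick _ m2.
have [c c0 [cl cU]] := pick _ m3.
have ba : b \notin <[a]>%VS.
  apply: contraNN b0 => /vlineP[s bE]; rewrite -memv0 -(line_preim_cap o12).
  by rewrite memv_cap bU bE memvZ.
have lE x y : x != 0 -> x \in l -> y \in l -> y \notin <[x]>%VS -> l = (<[x]> + <[y]>)%VS.
  move=> x0 xl yl yx; apply/esym/eqP; rewrite eqEdim subv_add -!memvE xl yl.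
  by rewrite dl dim_span2.
move: (cl); rewrite {1}(lE a b) // => /memv_addP[_ /vlineP[al1 ->] [_ /vlineP[be1 ->] cE]].
have [aW [om1 [a1 a2]]] := line_preimP _ (pt_neq0 o1) aU.
have [bW [om2 [b1 b2]]] := line_preimP _ (pt_neq0 o2) bU.
have [cW [om [c1 c2]]] := line_preimP _ (pt_neq0 o3) cU.
have om0 : om != 0.
  by apply: contraNneq c0 => om0; rewrite (th_inj cW) // ?c1 ?c2 om0 scaler0.
have d12 := det_pt o12; have d13 := det_pt o13.
have d32 : det (pt o3) (pt o2) != 0 by apply: det_pt; rewrite eq_sym.
set p1 := pt o1 in a1 a2 d12 d13 *; set p2 := pt o2 in b1 b2 d12 d32 *.
set p3 := pt o3 in c1 c2 d13 d32.
have E1 := c1; rewrite cE !linearP /= linearZ /= a1 b1 in E1.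
have E2 := c2; rewrite cE !linearP /= linearZ /= a2 b2 in E2.
have sc r (x : L) : r *: x = in_alg L r * x by rewrite mulr_algl.
rewrite !sc in E1 E2.
(* Cramer's rule for [al1 om1 p1 + be1 om2 p2 = om p3]: both [om1] and [om2] are [F]-multiples of
   [om], so rescaling [a] and [b] by scalars of [F] gives all three the same factor. *)
have K1 : (al1 * det p1 p2) *: om1 = det p3 p2 *: om.
  rewrite !sc; transitivity (in_alg L p2.2 * (in_alg L p3.1 * om) - in_alg L p2.1 * (in_alg L p3.2 * om)).
    by rewrite -E1 -E2 /det; ring.
  by rewrite /det; ring.
have K2 : (be1 * det p1 p2) *: om2 = det p1 p3 *: om.
  rewrite !sc; transitivity (in_alg L p1.1 * (in_alg L p3.2 * om) - in_alg L p1.2 * (in_alg L p3.1 * om)).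
    by rewrite -E1 -E2 /det; ring.
  by rewrite /det; ring.
have al0 : al1 != 0.
  apply: contraNneq d32 => al0; move/eqP: K1; rewrite al0 mul0r scale0r eq_sym scaler_eq0.
  by rewrite (negPf om0) orbF.
have be0 : be1 != 0.
  apply: contraNneq d13 => be0; move/eqP: K2; rewrite be0 mul0r scale0r eq_sym scaler_eq0.
  by rewrite (negPf om0) orbF.
pose e1 := (det p3 p2)^-1 * (al1 * det p1 p2); pose e2 := (det p1 p3)^-1 * (be1 * det p1 p2).
have e10 : e1 != 0 by rewrite !mulf_neq0 ?invr_neq0.
have e20 : e2 != 0 by rewrite !mulf_neq0 ?invr_neq0.
have O1 : e1 *: om1 = om by rewrite -scalerA K1 scalerA mulVf // scale1r.
have O2 : e2 *: om2 = om by rewrite -scalerA K2 scalerA mulVf // scale1r.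
exists (e1 *: a), (e2 *: b), om; split=> //.
- apply: lE; [by rewrite scaler_eq0 negb_or e10 | exact: memvZ | exact: memvZ |].
  apply: contra ba => /vlineP[s E]; have := congr1 ( *:%R e2^-1) E.
  rewrite scalerA mulVf // scale1r => ->; do 3!apply: memvZ; exact: memv_line.
- by split; rewrite linearZ /= ?a1 ?a2 -O1 !scalerA mulrC.
by split; rewrite linearZ /= ?b1 ?b2 -O2 !scalerA mulrC.
Qed.

Lemma field_regulus_is_regulus : is_regulus n W field_regulus.
Proof.
have n0 : (0 < n)%N by rewrite adim_gt0.
have inj : injective (fun o => line_preim (pt o)).
  move=> o o' E; apply/eqP; apply: contraT => oo'; move: n0.
  rewrite -(dim_line_preim (pt_neq0 o)) -[line_preim (pt o)]capvv [X in (X :&: _)%VS]E capvC.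
  by rewrite line_preim_cap // dimv0.
split.
- by rewrite map_inj_uniq ?enum_uniq // size_map -cardE card_option addn1.
- by move=> _ /field_regulusP[o ->]; rewrite capvSl dim_line_preim ?pt_neq0.
- move=> _ _ /field_regulusP[o ->] /field_regulusP[o' ->] oo'.
  by apply: line_preim_cap; apply: contraNneq oo' => ->.
move=> l _ _ _ dl lW /field_regulusP[o1 ->] /field_regulusP[o2 ->] /field_regulusP[o3 ->].
move=> n12 n13 n23 m1 m2 m3.
have neq o o' : line_preim (pt o) != line_preim (pt o') -> o != o'.
  by apply: contraNneq => ->.
have [a [b [om [om0 lE [a1 a2] [b1 b2]]]]] :=
  transversal_frame lW dl (neq _ _ n12) (neq _ _ n13) (neq _ _ n23) m1 m2 m3.
have d12 := det_pt (neq _ _ n12); move: a1 a2 b1 b2 d12.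
move: (pt o1) (pt o2) => [s1 t1] [s2 t2] /= a1 a2 b1 b2 d12.
have th_comb x y : th1 (x *: a + y *: b) = (x * s1 + y * s2) *: om
    /\ th2 (x *: a + y *: b) = (x * t1 + y * t2) *: om.
  by rewrite !linearP /= !linearZ /= a1 a2 b1 b2 !scalerA -!scalerDl.
have comb_l x y : x *: a + y *: b \in l.
  by rewrite lE memv_add // memvZ // memv_line.
split.
  move=> _ /field_regulusP[o ->]; move: (pt_neq0 o); move: (pt o) => [s t] st0.
  (* Cramer's solution of [x (s1, t1) + y (s2, t2) = (s, t)]. *)
  pose x := (s * t2 - s2 * t) / det (s1, t1) (s2, t2).
  pose y := (s1 * t - s * t1) / det (s1, t1) (s2, t2).
  have [h1 h2] := th_comb x y.
  have xs : x * s1 + y * s2 = s by rewrite /x /y /det /=; field.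
  have xt : x * t1 + y * t2 = t by rewrite /x /y /det /=; field.
  rewrite xs in h1; rewrite xt in h2.
  set w := x *: a + y *: b in h1 h2.
  have wl : w \in l by apply: comb_l.
  have w0 : w != 0.
    apply: contraNneq st0 => w0; move: h1 h2; rewrite w0 !linear0 xpair_eqE.
    move=> /esym/eqP; rewrite scaler_eq0 (negPf om0) orbF => ->.
    by move=> /esym/eqP; rewrite scaler_eq0 (negPf om0) orbF => ->.
  apply: contraNneq w0 => E; rewrite -memv0 -E memv_cap wl /=.
  apply/line_preimP => //; split; first exact: (subvP lW).
  by exists om.
move=> P dP Pl; have P0 : vpick P != 0 by rewrite vpick0 -dimv_eq0 dP.
have pl : vpick P \in l by apply/(subvP Pl)/memv_pick.
have PE : P = <[vpick P]>%VS.
  by apply/esym/eqP; rewrite eqEdim -memvE memv_pick dP dim_vline P0.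
move: (pl); rewrite lE => /memv_addP[_ /vlineP[x ->] [_ /vlineP[y ->] pE]].
have [h1 h2] := th_comb x y; rewrite -pE in h1 h2.
have st0 : (x * s1 + y * s2, x * t1 + y * t2) != (0, 0).
  apply: contraNneq P0 => -[E1 E2]; apply/eqP/th_inj; first exact: (subvP lW).
    by rewrite h1 E1 scale0r.
  by rewrite h2 E2 scale0r.
have [o [z [z0 sE tE]]] := pt_repr st0.
exists (line_preim (pt o)); first by apply/field_regulusP; exists o.
rewrite PE -memvE; apply/line_preimP; first exact: pt_neq0.
split; first exact: (subvP lW).
by exists (z *: om); rewrite h1 h2 sE tE !scalerA ![_ * z]mulrC.
Qed.

End FieldRegulus.

(* Linear forms with values in [L] that present the quotient by [pi i] as a
   plane over [L] in which [pi j], [pi l] and [pi m] are the lines through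
   [(1, 0)], [(0, 1)] and [(1, 1)]. *)
Definition field_forms (F : finFieldType) (n k : nat)
    (pi : 'I_k -> {vspace 'rV[F]_(3 * n)}) (i j l m : 'I_k) : Prop :=
  exists (L : fieldExtType F) (th1 th2 : 'Hom('rV[F]_(3 * n), L)),
    [/\ \dim {:L} = n,
        forall w, th1 w = 0 -> th2 w = 0 -> w \in pi i,
        forall r, exists c1 c2 : L, forall w, w \in (pi i + pi r)%VS ->
          exists om, th1 w = om * c1 /\ th2 w = om * c2
      & forall w, [/\ w \in (pi i + pi j)%VS -> th2 w = 0,
          w \in (pi i + pi l)%VS -> th1 w = 0
        & w \in (pi i + pi m)%VS -> th1 w = th2 w]].

(** * From linear forms to regular spreads *)

Section FormsToSpread.

Variables (F : finFieldType) (n : nat).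
Local Notation k := (#|F| ^ n + 2)%N.
Variables (pi : 'I_k -> {vspace 'rV[F]_(3 * n)}) (W : {vspace 'rV[F]_(3 * n)}) (i : 'I_k).
Hypotheses (arc : generalized_arc pi) (dW : \dim W = (2 * n)%N) (W0 : (W :&: pi i = 0)%VS).

Lemma regular_spread_of_forms :
    (forall j l m, j != i -> l != i -> m != i -> j != l -> j != m -> l != m ->
       field_forms pi i j l m) ->
  regular_spread n W (projected_spread pi i W).
Proof.
move=> forms; split; first exact: projected_is_spread.
move=> _ _ _ /projected_spreadP[j ji ->] /projected_spreadP[l li ->] /projected_spreadP[m mi ->].
move=> njl njm nlm.
have [|||L [th1 [th2 [dL thi thr thc]]]] := forms j l m ji li mi.
- by apply: contraNneq njl => ->.
- by apply: contraNneq njm => ->.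
- by apply: contraNneq nlm => ->.
have dWL : \dim W = (2 * \dim {:L})%N by rewrite dL.
have th_inj w : w \in W -> th1 w = 0 -> th2 w = 0 -> w = 0.
  by move=> wW h1 h2; apply/eqP; rewrite -memv0 -W0 memv_cap wW thi.
have SE r st : r != i -> st != (0, 0) ->
    (forall w, w \in (pi i + pi r)%VS -> st.2 *: th1 w = st.1 *: th2 w) ->
    ((pi i + pi r) :&: W)%VS = line_preim W th1 th2 st.
  move=> ri st0 h; apply/eqP; rewrite eqEdim (dim_projected arc dW W0 ri) dim_line_preim // dL leqnn andbT.
  by apply/subvP => w /memv_capP[wr wW]; rewrite mem_line_preim wW h ?eqxx.
exists (field_regulus W th1 th2); split.
- by have := field_regulus_is_regulus dWL th_inj; rewrite dL.
- split; apply/field_regulusP.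
  + exists (Some 0); apply: (SE _ _ _ (pt_neq0 _)) => // w wj; have [-> // _ _] := thc w.
    by rewrite scale0r scaler0.
  + exists None; apply: (SE _ _ _ (pt_neq0 _)) => // w wl; have [_ -> // _] := thc w.
    by rewrite scale0r scaler0.
  by exists (Some 1); apply: (SE _ _ _ (pt_neq0 _)) => // w wm; have [_ _ ->] := thc w.
move=> _ /field_regulusP[o ->]; apply/projected_spreadP.
(* The spread covers a vector [w] above the point [pt o]. The element containing it maps into a
   single [L]-line, necessarily that through [pt o], so it is the given member of the regulus. *)
have [w wW [h1 h2]] := th_surj dWL th_inj (pt o).1%:A (pt o).2%:A.
have w0 : w != 0.
  apply: contraNneq (pt_neq0 o) => w0; move: h1 h2; rewrite w0 !linear0; case: (pt o) => s t /=.
  move=> /esym/eqP; rewrite scaler_eq0 oner_eq0 orbF => /eqP->.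
  by move=> /esym/eqP; rewrite scaler_eq0 oner_eq0 orbF => /eqP->.
have [r ri /memv_capP[wr _]] := projected_cover arc dW W0 wW w0.
exists r => //; apply/esym/SE => //; first exact: pt_neq0.
have [c1 [c2 hc]] := thr r; have [om [o1 o2]] := hc w wr.
move=> w' /hc[om' [-> ->]]; rewrite h1 in o1; rewrite h2 in o2.
have om0 : om != 0.
  apply: contraNneq w0 => om0; apply/eqP/th_inj; rewrite // ?h1 ?h2 ?o1 ?o2 om0 mul0r //.
rewrite -[_ *: (om' * c1)]mulr_algl -[_ *: (om' * c2)]mulr_algl o1 o2; ring.
Qed.

End FormsToSpread.

(** * The linear forms of a field-reduced hyperoval *)

Section FieldReducedForms.

Variables (F : finFieldType) (n : nat).
Local Notation k := (#|F| ^ n + 2)%N.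
Variables (pi pi' : 'I_k -> {vspace 'rV[F]_(3 * n)}) (g : 'End('rV[F]_(3 * n))).
Hypotheses (arc : generalized_arc pi) (kerg : lker g = 0%VS).
Hypothesis piE : forall i, pi i = (g @: pi' i)%VS.

Lemma field_reduced_forms i j l m : i != j -> i != l -> i != m ->
    j != l -> j != m -> l != m ->
  field_reduced_hyperoval pi' -> field_forms pi i j l m.
Proof.
move=> ij il im jl jm lm [L [xi [x [dimL dxi sumxi [xinj xdim xcol] pi'E]]]].
pose e r := vpick (x r).
have e0 r : e r != 0 by rewrite vpick0 -dimv_eq0 (xdim r).1.
have xE r : x r = <[e r]>%VS.
  by apply/esym/eqP; rewrite eqEdim -memvE memv_pick (xdim r).1 dim_vline e0.
have e_xi r : e r \in xi by rewrite (subvP (xdim r).2) // memv_pick.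
have e_line r s : r != s -> e s \notin <[e r]>%VS.
  move=> rs; apply: contraNN rs => h; apply/eqP/xinj/esym/eqP.
  by rewrite eqEdim !(xdim _).1 leqnn andbT !xE -memvE.
have e_plane r s t : r != s -> r != t -> s != t -> e t \notin (<[e r]> + <[e s]>)%VS.
  move=> rs rt st; apply/negP => h; case: (xcol r s t rs rt st).
  exists (<[e r]> + <[e s]>)%VS; first by rewrite dim_span2 ?e_line.
  by rewrite !xE addvSl addvSr -memvE.
have xiE : xi = (<[e i]> + <[e j]> + <[e l]>)%VS.
  apply/esym/eqP; rewrite eqEdim !subv_add -!memvE !e_xi dxi /=.
  rewrite dimv_disjoint_sum ?dim_span2 ?e_line // ?dim_vline ?e0 //.
  apply/eqP; rewrite -subv0; apply/subvP => w /memv_capP[wp /vlineP[a wE]].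
  rewrite memv0; apply: contraNT (e_plane i j l ij il jl) => w0.
  have a0 : a != 0 by apply: contraNneq w0 => a0; rewrite wE a0 scale0r.
  by move: wp => /(memvZ a^-1); rewrite wE scalerA mulVf // scale1r.
have /memv_addP[_ /memv_addP[_ /vlineP[a ->] [_ /vlineP[b ->] ->]] [_ /vlineP[c ->] emE]] :
  e m \in (<[e i]> + <[e j]> + <[e l]>)%VS by rewrite -xiE.
have b0 : b != 0.
  apply: contraNneq (e_plane i l m il im lm) => b0.
  by rewrite emE b0 scale0r addr0 memv_add // memvZ ?memv_line.
have c0 : c != 0.
  apply: contraNneq (e_plane i j m ij im jm) => c0.
  by rewrite emE c0 scale0r addr0 memv_add // memvZ ?memv_line.
(* The scaling by the coefficients of [e m] makes [e m] project from [p] to the unit point; [b] and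
   [c] are nonzero because no three points of the hyperoval are collinear. *)
pose p := e i; pose u := b *: e j; pose v := c *: e l.
have coords w : w \in xi -> exists c1 c2 c3 : L, w = c1 *: p + c2 *: u + c3 *: v.
  rewrite xiE => /memv_addP[_ /memv_addP[_ /vlineP[c1 ->] [_ /vlineP[c2 ->] ->]] [_ /vlineP[c3 ->] ->]].
  by exists c1, (c2 / b), (c3 / c); rewrite !scalerA !divfK.
have lin : linear (fun y : L * L * L => Tr (y.1.1 *: p + y.1.2 *: u + y.2 *: v)).
  move=> t y y'; rewrite -TrZ -TrD /=; congr Tr.
  rewrite !scalerDl !scalerDr !scalerA !mulr_algl.
  by rewrite (addrACA (_ *: p)) (addrACA (_ + _)).
pose h0 := GRing.isLinear.Build _ _ _ _ _ lin.
pose h1 : {linear (L * L * L)%type -> 'rV[F]_(3 * n)} :=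
  HB.pack (fun y : L * L * L => Tr (y.1.1 *: p + y.1.2 *: u + y.2 *: v)) h0.
pose h := linfun h1.
have hE c1 c2 c3 : h (c1, c2, c3) = Tr (c1 *: p + c2 *: u + c3 *: v) by rewrite lfunE.
(* The image contains the trace of all of [xi], so its extension contains every conjugate of [xi]
   and is full. Equality of dimensions then makes [h] bijective. *)
have himg : limg h = fullv.
  apply/eqP; rewrite eqEsubv subvf; apply/subvP => w _; apply: mem_in_alg.
  apply: (subvP (gal_sum_sub (U := xi) _)); last by rewrite sumxi memvf.
  by move=> _ /coords[c1 [c2 [c3 ->]]]; rewrite -hE memv_img ?memvf.
have hker : lker h = 0%VS.
  apply/eqP; rewrite -dimv_eq0; have := limg_ker_dim h fullv.
  rewrite himg capfv dim_rV => E; rewrite -(eqn_add2r (3 * n)) E dimvf.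
  by rewrite -[dim _]/(dim L + dim L + dim L)%N -dimvf dimL; apply/eqP; lia.
pose f := (g \o h)%VF.
have fE c1 c2 c3 : f (c1, c2, c3) = g (Tr (c1 *: p + c2 *: u + c3 *: v)).
  by rewrite comp_lfunE hE.
have finj : injective f.
  move=> y y'; rewrite !comp_lfunE => /(lker0P (introT eqP kerg)).
  exact: (lker0P (introT eqP hker)).
have fker : lker f == 0%VS by apply/lker0P.
have fK := lker0_lfunK fker.
have fVK w : f (f^-1%VF w) = w.
  apply: limg_lfunVK; rewrite limg_comp himg.
  suffices -> : limg g = fullv by rewrite memvf.
  by apply: lker0_limgf; rewrite kerg.
pose th1 := (linfun snd \o linfun fst \o f^-1)%VF : 'Hom('rV[F]_(3 * n), L).
pose th2 := (linfun snd \o f^-1)%VF : 'Hom('rV[F]_(3 * n), L).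
have th1E w : th1 w = (f^-1%VF w).1.2 by rewrite !comp_lfunE !lfunE.
have th2E w : th2 w = (f^-1%VF w).2 by rewrite !comp_lfunE !lfunE.
have Tr_e r om : g (Tr (om *: e r)) \in pi r.
  rewrite piE memv_img // (Tr_mem_of_sum (pi'E r)) // memvZ //; exact: memv_pick.
have th_r r c1 c2 c3 : e r = c1 *: p + c2 *: u + c3 *: v ->
    forall w, w \in pi r -> exists om, th1 w = om * c2 /\ th2 w = om * c3.
  move=> erE w.
  have qlin : linear (fun om : L => f (om * c1, om * c2, om * c3)).
    move=> t y y'; rewrite -linearP; congr (f _).
    by rewrite !mulrDl -!scalerAl.
  pose q0 := GRing.isLinear.Build _ _ _ _ _ qlin.
  pose q1 : {linear L -> 'rV[F]_(3 * n)} :=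
    HB.pack (fun om : L => f (om * c1, om * c2, om * c3)) q0.
  have qE om : linfun q1 om = g (Tr (om *: e r)).
    by rewrite lfunE /= fE erE !scalerDr !scalerA.
  (* The traces of the [L]-multiples of [e r], moved by [g], lie in [pi r] and already form a space
     of dimension [n]. *)
  have -> : pi r = limg (linfun q1).
    apply/esym/eqP; rewrite eqEdim (arc_dim arc) limg_dim_eq ?dimL ?leqnn ?andbT.
      by apply/subvP => _ /memv_imgP[om _ ->]; rewrite qE.
    apply/eqP; rewrite -subv0; apply/subvP => om /memv_capP[_].
    rewrite memv_ker memv0 lfunE /= -(linear0 f) => /eqP/finj[z1 z2 z3].
    apply: contraNT (e0 r) => om0; rewrite erE.
    have cz (y : L) : om * y = 0 -> y = 0.
      by move/eqP; rewrite mulf_eq0 (negPf om0) => /eqP.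
    by rewrite (cz _ z1) (cz _ z2) (cz _ z3) !scale0r !addr0.
  case/memv_imgP=> om _ ->; exists om.
  by rewrite th1E th2E !lfunE /= fK.
have th_i w : w \in pi i -> th1 w = 0 /\ th2 w = 0.
  have /th_r h' : e i = 1 *: p + 0 *: u + 0 *: v by rewrite scale1r !scale0r !addr0.
  by move=> /h'[om [-> ->]]; rewrite !mulr0.
have th_ir r c1 c2 c3 : e r = c1 *: p + c2 *: u + c3 *: v ->
    forall w, w \in (pi i + pi r)%VS -> exists om, th1 w = om * c2 /\ th2 w = om * c3.
  move=> /th_r h' w /memv_addP[y /th_i[y1 y2] [z /h'[om [z1 z2]] ->]].
  by exists om; rewrite !linearD /= y1 y2 z1 z2 !add0r.
exists L, th1, th2; split=> //.
- move=> w; rewrite th1E th2E => w1 w2; rewrite -[w]fVK.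
  case E : (f^-1%VF w) w1 w2 => [[om ?] ?] /= -> ->.
  by rewrite fE !scale0r !addr0; apply: Tr_e.
- move=> r; have [c1 [c2 [c3 /th_ir h']]] := coords _ (e_xi r).
  by exists c2, c3.
have ejE : e j = 0 *: p + b^-1 *: u + 0 *: v.
  by rewrite !scale0r add0r addr0 scalerA mulVf // scale1r.
have elE : e l = 0 *: p + 0 *: u + c^-1 *: v.
  by rewrite !scale0r !add0r scalerA mulVf // scale1r.
have emE' : e m = a *: p + 1 *: u + 1 *: v by rewrite !scale1r.
move=> w; split.
- by case/(th_ir _ _ _ _ ejE)=> om [_ ->]; rewrite mulr0.
- by case/(th_ir _ _ _ _ elE)=> om [-> _]; rewrite mulr0.
by case/(th_ir _ _ _ _ emE')=> om [-> ->].
Qed.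

End FieldReducedForms.

Theorem theorem6p1 (F : finFieldType) (h n : nat)
    (hq : #|F| = (2 ^ h)%N) (hh : (1 < h)%N) (hn : prime n)
    (pi : 'I_(#|F| ^ n + 2) -> {vspace 'rV[F]_(3 * n)})
    (hpi : pseudo_hyperoval pi)
    (W : 'I_(#|F| ^ n + 2) -> {vspace 'rV[F]_(3 * n)})
    (hW : forall i, \dim (W i) = (2 * n)%N /\ (W i :&: pi i = 0)%VS) :
  regular_pseudo_hyperoval pi <->
  (forall i, regular_spread n (W i) (projected_spread pi i (W i))).
Proof.
have q_gt2 : (2 < #|F|)%N.
  by rewrite hq; apply: (@leq_trans (2 ^ 2)%N); rewrite // leq_exp2l.
(* The ring structure on square matrices requires a size of successor form; size 0 is not prime. *)
case: n hn pi hpi W hW => // n' hn pi hpi W hW.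
have k_gt2 : (2 < #|F| ^ n'.+1 + 2)%N.
  by rewrite addn2 !ltnS expn_gt0 (ltnW (ltnW q_gt2)).
split=> [[g [pi' [kerg red piE]]] i | reg].
  have [dW W0] := hW i; apply: regular_spread_of_forms => // j l m ji li mi jl jm lm.
  by apply: (field_reduced_forms hpi kerg piE); rewrite // eq_sym.
have reg_at i : regular_at pi i.
  by have [dW W0] := hW i; apply: (regular_spread_at k_gt2 hpi _ dW W0).
have [Pa [Pb [Pc [M [irr degM coordP]]]]] :=
  arc_common_field q_gt2 hn (erefl _) hpi reg_at.
exists \1%VF, pi; split=> [||i].
- by apply/eqP/lker0P => x y; rewrite !id_lfunE.
- exact: field_reduced_of_common_field irr degM coordP.
by rewrite lim1g.
Qed.
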